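(* Let $P\subseteq\mathbb{R}^{p+q}$ be a rational polyhedron with $P_I\ne\emptyset$, let $cx+hy$ be an objective function bounded above on $P$, $\gamma^*=\max\{cx+hy:(x,y)\in P_I\}$ and $M=\{(x,y)\in P_I: cx+hy=\gamma^*\}$. Let $k\ge2$. Suppose that for every nonempty face $f$ of $M$ (including $M$ itself) with $\mathrm{relint}(\mathrm{proj}_X(f))\cap\mathbb{Z}^p=\emptyset$ there exists a $k$-disjunction $d^1x\le\delta^1,\dots,d^kx\le\delta^k$ such that every $x\in\mathrm{relint}(\mathrm{proj}_X(f))$ satisfies $d^ix>\delta^i$ for all $i=1,\dots,k$. Then there exists $n\in\mathbb{N}$ with $\sup\{cx+hy:(x,y)\in P^{(n)}_k\}=\gamma^*$.
   Context: $P_I=\mathrm{conv}\{(x,y)\in P:x\in\mathbb{Z}^p\}$; $\mathrm{proj}_X(S)=\{x:\exists y,(x,y)\in S\}$. A $k$-disjunction ($k\ge 2$) is a family of inequalities $d^1x\le\delta^1,\dots,d^kx\le\delta^k$ with $d^i\in\mathbb{Z}^p$ (not necessarily distinct), $\delta^i\in\mathbb{Z}$, such that every $x\in\mathbb{Z}^p$ satisfies $d^ix\le\delta^i$ for some $i$. For a closed convex set $C\subseteq\mathbb{R}^{p+q}$, an inequality $\alpha x+\beta y\le\gamma$ is a $k$-disjunctive cut for $C$ if it is not valid for $C$ and there is a $k$-disjunction such that every $(x,y)\in C$ with $\alpha x+\beta y>\gamma$ satisfies $d^ix>\delta^i$ for all $i$. The $k$-disjunctive closure of $C$ is the intersection of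 $C$ with all half-spaces given by $k$-disjunctive cuts for $C$; $P^{(0)}_k=P$ and $P^{(n)}_k$ is the $k$-disjunctive closure of $P^{(n-1)}_k$. *)

(* Defs.v *)
From Stdlib Require Import Reals List QArith Qreals.
From mathcomp Require Import all_boot.
Set Implicit Arguments. Unset Strict Implicit. Unset Printing Implicit Defensive.
Open Scope R_scope.

Definition pt (p q : nat) := (('I_p -> R) * ('I_q -> R))%type.

Definition dot (n : nat) (a x : 'I_n -> R) : R :=
  foldr Rplus 0 [seq a i * x i | i <- enum 'I_n].

Definition lin (p q : nat) (a : 'I_p -> R) (b : 'I_q -> R) (z : pt p q) : R :=
  dot a z.1 + dot b z.2.

Definition is_int_vec (n : nat) (x : 'I_n -> R) : Prop :=
  forall i, exists z : Z, x i = IZR z.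

Definition rat_polyhedron (p q : nat) (cs : seq ((('I_p -> Q) * ('I_q -> Q)) * Q))
  : pt p q -> Prop :=
  fun z => forall c, In c cs ->
    lin (fun i => Q2R (c.1.1 i)) (fun j => Q2R (c.1.2 j)) z <= Q2R c.2.

Definition wsum (A : Type) (l : seq (R * A)) (f : A -> R) : R :=
  foldr (fun w acc => w.1 * f w.2 + acc) 0 l.
Definition wtotal (A : Type) (l : seq (R * A)) : R :=
  foldr (fun w acc => w.1 + acc) 0 l.

Definition conv (p q : nat) (S : pt p q -> Prop) : pt p q -> Prop :=
  fun z => exists l : seq (R * pt p q),
    (forall w, In w l -> 0 <= w.1 /\ S w.2) /\ wtotal l = 1 /\
    (forall i, z.1 i = wsum l (fun u => u.1 i)) /\
    (forall j, z.2 j = wsum l (fun u => u.2 j)).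

Definition integer_hull (p q : nat) (P : pt p q -> Prop) : pt p q -> Prop :=
  conv (fun z => P z /\ is_int_vec z.1).

Definition proj_X (p q : nat) (S : pt p q -> Prop) : ('I_p -> R) -> Prop :=
  fun x => exists y, S (x, y).

Definition aff (n : nat) (S : ('I_n -> R) -> Prop) : ('I_n -> R) -> Prop :=
  fun v => exists l : seq (R * ('I_n -> R)),
    (forall w, In w l -> S w.2) /\ wtotal l = 1 /\
    (forall i, v i = wsum l (fun u => u i)).

(* relative interior (w.r.t. the sup-norm, equivalent to any norm) *)
Definition relint (n : nat) (S : ('I_n -> R) -> Prop) : ('I_n -> R) -> Prop :=
  fun x => S x /\ exists eps, 0 < eps /\
    forall x', aff S x' -> (forall i, Rabs (x' i - x i) < eps) -> S x'.

(* F is a nonempty face of M: F = M ∩ {a x + b y = beta} for a valid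
   inequality a x + b y <= beta of M (a = b = 0, beta = 0 gives M itself) *)
Definition nonempty_face (p q : nat) (M F : pt p q -> Prop) : Prop :=
  (exists z, F z) /\
  exists (a : 'I_p -> R) (b : 'I_q -> R) (beta : R),
    (forall z, M z -> lin a b z <= beta) /\
    (forall z, F z <-> (M z /\ lin a b z = beta)).

Definition dvec (k p : nat) (d : 'I_k -> 'I_p -> Z) (i : 'I_k) : 'I_p -> R :=
  fun j => IZR (d i j).

Definition k_disjunction (k p : nat) (d : 'I_k -> 'I_p -> Z) (delta : 'I_k -> Z) : Prop :=
  forall x : 'I_p -> R, is_int_vec x -> exists i, dot (dvec d i) x <= IZR (delta i).

Definition kdisj_cut (k p q : nat) (C : pt p q -> Prop)
  (a : 'I_p -> R) (b : 'I_q -> R) (g : R) : Prop :=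
  (exists z, C z /\ lin a b z > g) /\
  exists (d : 'I_k -> 'I_p -> Z) (delta : 'I_k -> Z),
    k_disjunction d delta /\
    forall z, C z -> lin a b z > g -> forall i, dot (dvec d i) z.1 > IZR (delta i).

Definition kdisj_closure (k p q : nat) (C : pt p q -> Prop) : pt p q -> Prop :=
  fun z => C z /\ forall a b g, kdisj_cut k C a b g -> lin a b z <= g.

Fixpoint kdisj_rank (k p q : nat) (P : pt p q -> Prop) (n : nat) : pt p q -> Prop :=
  match n with
  | O => P
  | S m => kdisj_closure k (kdisj_rank k P m)
  end.

(* Main.v *)
Require Import Defs.
From Stdlib Require Import Reals List QArith Qreals FunctionalExtensionality.
From mathcomp Require Import all_boot all_order all_algebra ring lra.
From mathcomp Require Import Rstruct.

(** An inequality is reached if it is valid for some [P^(n)]; we must reach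
    [v <= 0], where [v = cx + hy - gstar].  By Meyer's theorem the integer hull is
    generated by finitely many integral vectors, which reduces the problem to
    integral [v] and allows an induction on the number of generators tight for [v].

    Splits alone reach every valid inequality of the integer hull up to an
    arbitrary [eps > 0].  If the relative interior of [proj_X M] contains an
    integral point [xb], LP duality over the fiber above [xb] gives [m v <= W(x)]
    on [P], with [m > 0] and [W] integral affine and zero on [M].  As
    [W + N v <= 0] is valid for large [N], [W + N v <= 1/2] is reached, and then
    the split [0 < W < 1] yields [v <= 0].

    Otherwise, let [pi] be an integral affine projection onto the affine hull of
    [proj_X M].  For each facet [alpha x <= gamma] of [proj_X M], an inequality
    [alpha (pi x) - gamma + K v <= 0] is reached by induction, its optimal face
    being a proper face of [M].  Hence [v > 0] forces [pi x] into the relative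
    interior of [proj_X M], and composing the given disjunction with [pi] yields
    the cut [v <= 0]. *)

Set Implicit Arguments. Unset Strict Implicit. Unset Printing Implicit Defensive.
Import Order.TTheory GRing.Theory Num.Theory.
Local Open Scope ring_scope.

(** * Finitely generated cones *)

Section Cones.
Context {F : archiRealFieldType}.

(** A closure is cut out by possibly infinitely many half-spaces, so nothing is proved about its
    shape: only reached inequalities are handled, and these form a convex cone. Suprema over the
    closures need not be attained, hence the limits and multipliers in [lex]. The margin [eps] is
    needed because finitely many rounds of split cuts can miss a valid mixed-integer inequality;
    removing it is the task of [W] and of the given disjunctions. Disjunctions need integral data.
    Therefore Weyl and Minkowski are proved with integral output, [v] is made integral so that [W]
    is, and [pi] comes from a Smith normal form: an orthogonal projection would not send integral
    points to integral points. *)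

Fixpoint cone (V : lmodType F) (G : seq V) (z : V) : Prop :=
  if G is g :: G' then exists2 t, 0 <= t & cone G' (z - t *: g) else z = 0.

Section ConeTheory.
Context {V : lmodType F}.
Implicit Types (G : seq V) (x y z : V).

Lemma cone0 G : cone G 0.
Proof. by elim: G => //= g G IH; exists 0; rewrite // scale0r subr0. Qed.

Lemma coneD G x y : cone G x -> cone G y -> cone G (x + y).
Proof.
elim: G x y => [|g G IH] x y /=; first by move=> -> ->; rewrite addr0.
move=> [s s0 xs] [t t0 yt]; exists (s + t); first exact: addr_ge0.
by rewrite scalerDl opprD addrACA; apply: IH.
Qed.

Lemma coneZ G a x : 0 <= a -> cone G x -> cone G (a *: x).
Proof.
move=> a0; elim: G x => [|g G IH] x /=; first by move=> ->; rewrite scaler0.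
move=> [s s0 xs]; exists (a * s); first exact: mulr_ge0.
by rewrite -scalerA -scalerBr; apply: IH.
Qed.

Lemma cone_mem G g : g \in G -> cone G g.
Proof.
elim: G => //= g' G IH; rewrite inE => /predU1P[->|gG].
  by exists 1; rewrite ?ler01 // scale1r subrr; apply: cone0.
by exists 0; rewrite // scale0r subr0; apply: IH.
Qed.

Lemma cone_min (K : V -> Prop) G z :
  K 0 -> (forall x y, K x -> K y -> K (x + y)) ->
  (forall t g, 0 <= t -> g \in G -> K (t *: g)) -> cone G z -> K z.
Proof.
move=> K0 KD; elim: G z => [|g G IH] z KG /=; first by move=> ->.
move=> [t t0 zt]; rewrite -[z](subrK (t *: g)); apply: KD.
  by apply: IH zt => s h s0 hG; apply: KG => //; rewrite inE hG orbT.
by apply: KG => //; rewrite inE eqxx.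
Qed.

Lemma cone_sum (I : Type) G (r : seq I) (P : pred I) (f : I -> V) :
  (forall i, P i -> cone G (f i)) -> cone G (\sum_(i <- r | P i) f i).
Proof. by move=> fG; apply: big_ind => //; [apply: cone0|apply: coneD]. Qed.

Lemma sub_cone G G' z : {subset G <= G'} -> cone G z -> cone G' z.
Proof.
move=> GG'; apply: cone_min; [exact: cone0|exact: coneD|].
by move=> t g t0 /GG' gG'; apply: coneZ => //; apply: cone_mem.
Qed.

End ConeTheory.

Lemma cone_map (V W : lmodType F) (f : {linear V -> W}) (G : seq V) w :
  cone (map f G) w <-> exists2 z, cone G z & w = f z.
Proof.
split.
  elim: G w => [|g G IH] w /=; first by move=> ->; exists 0; rewrite ?linear0.
  move=> [t t0 /IH [z zG wz]]; exists (z + t *: g).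
    by exists t; rewrite // addrK.
  by rewrite linearD linearZ /= -wz subrK.
move=> [z zG ->]; move: z zG; elim: G => [|g G IH] z /=.
  by move=> ->; rewrite linear0.
by move=> [t t0 zt]; exists t => //; rewrite -linearZ -linearB; apply: IH.
Qed.

Definition ev n (f : 'cV[F]_n) (z : 'rV[F]_n) : F := (z *m f) 0 0.

Section Ev.
Context {n : nat}.
Implicit Types (f : 'cV[F]_n) (z : 'rV[F]_n).

Lemma ev0 f : ev f 0 = 0. Proof. by rewrite /ev mul0mx mxE. Qed.
Lemma evD f x y : ev f (x + y) = ev f x + ev f y.
Proof. by rewrite /ev mulmxDl mxE. Qed.
Lemma evZ f a x : ev f (a *: x) = a * ev f x.
Proof. by rewrite /ev -scalemxAl mxE. Qed.
Lemma evN f x : ev f (- x) = - ev f x.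
Proof. by rewrite /ev mulNmx mxE. Qed.
Lemma ev0l z : ev (0 : 'cV[F]_n) z = 0. Proof. by rewrite /ev mulmx0 mxE. Qed.
Lemma evDl f g z : ev (f + g) z = ev f z + ev g z.
Proof. by rewrite /ev mulmxDr mxE. Qed.
Lemma evZl a f z : ev (a *: f) z = a * ev f z.
Proof. by rewrite /ev -scalemxAr mxE. Qed.
Lemma evNl f z : ev (- f) z = - ev f z.
Proof. by rewrite /ev mulmxN mxE. Qed.
Lemma ev_tr f z : ev z^T f^T = ev f z.
Proof. by rewrite /ev -trmx_mul mxE. Qed.

Definition evE := (evD, evZ, evN, ev0, evDl, evZl, evNl, ev0l).

Lemma ev_delta (i : 'I_n) z : ev (delta_mx i 0) z = z 0 i.
Proof.
rewrite /ev mxE (bigD1 i) //= mxE !eqxx mulr1 big1 ?addr0 // => j ji.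
by rewrite mxE (negPf ji) mulr0.
Qed.

Lemma ev_cone f (G : seq 'rV[F]_n) z :
  (forall g, g \in G -> ev f g <= 0) -> cone G z -> ev f z <= 0.
Proof.
move=> fG; apply: (cone_min (K := fun z => ev f z <= 0)).
- by rewrite ev0.
- by move=> x y xf yf; rewrite evD; lra.
- by move=> t g t0 gG; rewrite evZ mulr_ge0_le0 // fG.
Qed.

End Ev.

Lemma ev_mul m n (A : 'M[F]_(m, n)) f z : ev f (z *m A) = ev (A *m f) z.
Proof. by rewrite /ev mulmxA. Qed.

(** * Integral matrices *)

Definition integral m n (A : 'M[F]_(m, n)) := forall i j, A i j \is a Num.int.

Section Integral.
Implicit Types m n : nat.

Lemma integral0 m n : integral (0 : 'M[F]_(m, n)).
Proof. by move=> i j; rewrite mxE. Qed.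
Lemma integralD m n (A B : 'M[F]_(m, n)) : integral A -> integral B -> integral (A + B).
Proof. by move=> iA iB i j; rewrite mxE rpredD. Qed.
Lemma integralN m n (A : 'M[F]_(m, n)) : integral A -> integral (- A).
Proof. by move=> iA i j; rewrite mxE rpredN. Qed.
Lemma integralZ m n a (A : 'M[F]_(m, n)) : a \is a Num.int -> integral A -> integral (a *: A).
Proof. by move=> ia iA i j; rewrite mxE rpredM. Qed.
Lemma integralM m n p (A : 'M[F]_(m, n)) (B : 'M[F]_(n, p)) :
  integral A -> integral B -> integral (A *m B).
Proof. by move=> iA iB i j; rewrite mxE rpred_sum // => l _; rewrite rpredM. Qed.
Lemma integral_tr m n (A : 'M[F]_(m, n)) : integral A -> integral A^T.
Proof. by move=> iA i j; rewrite mxE. Qed.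
Lemma integral_delta m n i j : integral (delta_mx i j : 'M[F]_(m, n)).
Proof. by move=> k l; rewrite mxE rpred_nat. Qed.
Lemma integral1 n : integral (1%:M : 'M[F]_n).
Proof. by move=> k l; rewrite mxE rpredMn ?rpred1. Qed.
Lemma integral_row_mx m n1 n2 (A : 'M[F]_(m, n1)) (B : 'M[F]_(m, n2)) :
  integral A -> integral B -> integral (row_mx A B).
Proof. by move=> iA iB i j; rewrite mxE; case: split. Qed.
Lemma integral_col_mx m1 m2 n (A : 'M[F]_(m1, n)) (B : 'M[F]_(m2, n)) :
  integral A -> integral B -> integral (col_mx A B).
Proof. by move=> iA iB i j; rewrite mxE; case: split. Qed.
Lemma integral_ev n (f : 'cV[F]_n) (z : 'rV[F]_n) :
  integral f -> integral z -> ev f z \is a Num.int.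
Proof. by move=> fi zi; apply: integralM. Qed.
End Integral.

(** In [weyl], [t] is the largest lower bound on a multiplier. Since it is 0 or attained, each upper
    bound is checked against a single pairwise inequality. *)
Lemma nonneg_ub (T : eqType) (s : seq T) (phi : T -> F) :
  exists t, [/\ 0 <= t, forall a, a \in s -> phi a <= t &
                t = 0 \/ exists2 a, a \in s & t = phi a].
Proof.
elim: s => [|a s [t [t0 ub tm]]]; first by exists 0; split=> //; left.
have [le_at|lt_ta] := leP (phi a) t.
  exists t; split=> //.
    by move=> b; rewrite inE => /predU1P[->|/ub].
  by case: tm => [|[b bs ->]]; [left|right; exists b; rewrite ?inE ?bs ?orbT].
exists (phi a); split.
- lra.
- by move=> b; rewrite inE => /predU1P[->//|/ub]; lra.
- by right; exists a; rewrite ?inE ?eqxx.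
Qed.

(* Adjoining a generator [g] eliminates the multiplier [t >= 0] from the
   inequalities [h z <= t * h g] (Fourier-Motzkin). *)
Lemma weyl n (G : seq 'rV[F]_n) : exists H : seq 'cV[F]_n,
  (forall z, cone G z <-> forall h, h \in H -> ev h z <= 0) /\
  ((forall g, g \in G -> integral g) -> forall h, h \in H -> integral h).
Proof.
elim: G => [|g G [H [HP Hint]]].
  exists ([seq delta_mx i 0 | i <- enum 'I_n] ++ [seq - delta_mx i 0 | i <- enum 'I_n]).
  split=> [z|_ h] /=; last first.
    rewrite mem_cat => /orP[] /mapP[i _ ->]; last apply: integralN; exact: integral_delta.
  split=> [-> h _|zH]; first by rewrite ev0.
  apply/rowP => i; rewrite mxE; apply/eqP; rewrite eq_le.
  have := zH (delta_mx i 0); have := zH (- delta_mx i 0).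
  rewrite !mem_cat (map_f (fun i => delta_mx i 0)) ?mem_enum // orTb.
  rewrite (map_f (fun i => - delta_mx i 0)) ?mem_enum // orbT.
  by move=> /(_ isT) + /(_ isT); rewrite evNl ev_delta; lra.
exists ([seq h <- H | ev h g <= 0] ++
  [seq ev a g *: b - ev b g *: a | a <- [seq h <- H | 0 < ev h g],
                                   b <- [seq h <- H | ev h g < 0]]).
split=> [z|gint h]; last first.
  rewrite mem_cat mem_filter => /orP[/andP[_ hH]|/allpairsP[[a b]] /=].
    by apply: Hint => // g' g'G; apply: gint; rewrite inE g'G orbT.
  rewrite !mem_filter => -[/andP[_ aH] /andP[_ bH] ->].
  have Hi h' : h' \in H -> integral h'.
    by apply: Hint => g' g'G; apply: gint; rewrite inE g'G orbT.
  have gi : integral g by apply: gint; rewrite inE eqxx.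
  by apply: integralD; [|apply: integralN]; apply: integralZ; auto;
    apply: integral_ev; auto.
split=> [[t t0 /HP zt] h|zH].
  have {}zt a : a \in H -> ev a z <= t * ev a g by move/zt; rewrite !evE; lra.
  rewrite mem_cat mem_filter => /orP[/andP[hg hH]|/allpairsP[[a b]] /=].
    by have := zt h hH; have := mulr_ge0_le0 t0 hg; lra.
  rewrite !mem_filter => -[/andP[ag aH] /andP[bg bH] ->]; rewrite !evE.
  by have := zt a aH; have := zt b bH; nra.
have [t [t0 ub tm]] := nonneg_ub [seq h <- H | 0 < ev h g] (fun h => ev h z / ev h g).
exists t => //; apply/HP => h hH; rewrite !evE subr_le0.
have [hg|hg|hg] := ltgtP (ev h g) 0.
- have hz : ev h z <= 0 by apply: zH; rewrite mem_cat mem_filter hH ltW.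
  case: tm => [->|[a]]; first by rewrite mul0r.
  rewrite mem_filter => /andP[ag aH ->].
  have := zH (ev a g *: h - ev h g *: a).
  rewrite mem_cat (allpairs_f (fun a b => ev a g *: b - ev b g *: a)) ?orbT
    ?mem_filter ?ag ?hg // => /(_ isT).
  rewrite !evE mulrAC ler_pdivlMr //; lra.
- have := ub h; rewrite mem_filter hg hH => /(_ isT).
  by rewrite ler_pdivrMr.
- have : ev h z <= 0 by apply: zH; rewrite mem_cat mem_filter hH hg lexx.
  by rewrite hg mulr0.
Qed.

Lemma farkas n (G : seq 'rV[F]_n) z : ~ cone G z ->
  exists f, [/\ forall g, g \in G -> ev f g <= 0, 0 < ev f z &
    (forall g, g \in G -> integral g) -> integral f].
Proof.
have [H [HP Hint]] := weyl G => nGz.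
have /hasP[f fH fz] : has (fun h => 0 < ev h z) H.
  apply: contra_notT nGz => /hasPn nH; apply/HP => h /nH; by rewrite -leNgt.
exists f; split=> // [g /cone_mem /HP|/Hint]; exact.
Qed.

(** Polarity exchanges generators and half-spaces: [weyl] describes the cone of the normals by [B],
    whose transposes generate the polar. A second use of [weyl] supplies the bipolar theorem. *)
Lemma minkowski n (H : seq 'cV[F]_n) : exists G : seq 'rV[F]_n,
  (forall z, (forall h, h \in H -> ev h z <= 0) <-> cone G z) /\
  ((forall h, h \in H -> integral h) -> forall g, g \in G -> integral g).
Proof.
have [B [BP Bint]] := weyl (map trmx H).
have BP' f : cone (map trmx H) f^T <-> forall b, b \in map trmx B -> ev f b <= 0.
  rewrite BP; split=> fB b; last by move/(map_f trmx)/fB; rewrite -ev_tr trmxK.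
  by move=> /mapP[b' b'B ->]; rewrite -ev_tr trmxK; apply: fB.
exists (map trmx B); split=> [z|Hint g /mapP[b bB ->]]; last first.
  apply: integral_tr; apply: Bint bB => _ /mapP[h hH ->]; exact/integral_tr/Hint.
split=> [zH|]; last first.
  move=> zB h hH; apply: ev_cone zB; apply/BP'; exact/cone_mem/map_f.
have [K [KP _]] := weyl (map trmx B); apply/KP => f fK.
have /BP' fH : forall b, b \in map trmx B -> ev f b <= 0.
  by move=> b /cone_mem /KP; apply.
rewrite -ev_tr; apply: ev_cone fH => _ /mapP[h hH ->].
by rewrite ev_tr; apply: zH.
Qed.

End Cones.

Section Cones2.
Context {F : archiRealFieldType}.

Lemma nat_ub (x : F) : exists N : nat, x <= N%:R.
Proof. by exists (Num.bound `|x|); have := archi_boundP (normr_ge0 x); have := ler_norm x; lra. Qed.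

(** Finitely many generators with [v] negative are bounded away from 0, so a large multiple of [v]
    outweighs [u] there. A natural [N] preserves integrality. *)
Lemma tilt n (G : seq 'rV[F]_n) (u v : 'cV[F]_n) :
  (forall g, g \in G -> ev v g <= 0) ->
  (forall g, g \in G -> ev v g = 0 -> ev u g <= 0) ->
  exists N : nat, forall g, g \in G -> ev u g + N%:R * ev v g <= 0.
Proof.
move=> v0 uv; have [t [t0 ub _]] :=
  nonneg_ub [seq g <- G | ev v g < 0] (fun g => ev u g / - ev v g).
have [N tN] := nat_ub t; exists N => g gG.
have [vg|vg|vg] := ltgtP (ev v g) 0.
- have := ub g; rewrite mem_filter vg gG => /(_ isT); rewrite ler_pdivrMr; last lra.
  nra.
- by have := v0 g gG; lra.
- by have := uv g gG vg; rewrite vg; lra.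
Qed.

Lemma cone_face n (G : seq 'rV[F]_n) (f : 'cV[F]_n) z :
  (forall g, g \in G -> ev f g <= 0) -> cone G z -> ev f z = 0 ->
  cone [seq g <- G | ev f g == 0] z.
Proof.
move=> fG zG; suff [_ //] : ev f z <= 0 /\ (ev f z = 0 -> cone [seq g <- G | ev f g == 0] z).
move: zG; apply: (cone_min (K := fun z => ev f z <= 0 /\
  (ev f z = 0 -> cone [seq g <- G | ev f g == 0] z))) => [|x y [x0 xG] [y0 yG]|t g t0 gG].
- by rewrite ev0; split=> // _; apply: cone0.
- rewrite evD; split=> [|xy]; first lra.
  by apply: coneD; [apply: xG|apply: yG]; lra.
- rewrite evZ; split=> [|tg]; first exact: mulr_ge0_le0 (fG _ _).
  move/eqP: tg; rewrite mulf_eq0 => /orP[/eqP ->|fg].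
    by rewrite scale0r; apply: cone0.
  by apply: coneZ => //; apply: cone_mem; rewrite mem_filter fg.
Qed.

Lemma integralP m n (A : 'M[F]_(m, n)) :
  integral A -> exists B : 'M[int]_(m, n), A = map_mx intr B.
Proof.
move=> iA; exists (\matrix_(i, j) Num.floor (A i j)).
by apply/matrixP => i j; rewrite !mxE floorK.
Qed.

(** [Pi] projects onto the row space of [A]. In Smith form [A = L D R] it is [R^-1 E R], where [E]
    selects the nonzero diagonal entries; [R] is unimodular, so [Pi] is integral. *)
Lemma integral_projection m p (A : 'M[F]_(m, p)) : integral A ->
  exists Pi : 'M[F]_p, [/\ integral Pi, A *m Pi = A & exists C, Pi = C *m A].
Proof.
move=> /integralP[B ->].
have [L Lu [R Ru [d _ ->]]] := int_Smith_normal_form B.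
pose i2F k l := @map_mx int F intr k l.
pose D : 'M[F]_(m, p) := \matrix_(i, j) ((d`_i)%:~R *+ (i == j :> nat)).
(* A pseudo-inverse of [D], as the inverse of 0 is 0 by convention. *)
pose D' : 'M[F]_(p, m) := \matrix_(i, j) ((d`_i)%:~R^-1 *+ (i == j :> nat)).
pose E : 'M[F]_p := \matrix_(i, j) ((d`_i != 0)%:R *+ ((i < m)%N && (i == j))).
have DE : D' *m D = E.
  apply/matrixP => i j; rewrite !mxE.
  have [im|im] := ltnP i m; last first.
    rewrite mulr0n big1 // => k _; rewrite !mxE.
    by case: eqP => [ik|]; rewrite ?mulr0n ?mul0r //; have := ltn_ord k; rewrite -ik ltnNge im.
  rewrite (bigD1 (Ordinal im)) //= big1 ?addr0 => [|k ki]; rewrite !mxE /=; last first.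
    case: eqP => [ik|]; rewrite ?mulr0n ?mul0r //.
    by case/eqP: ki; apply: val_inj.
  rewrite eqxx mulr1n -[in RHS]val_eqE /=; case: eqP => _; rewrite ?mulr0n ?mulr0 // !mulr1n.
  have [->|d0] := eqVneq d`_i 0; first by rewrite mulr0.
  by rewrite mulVf // intr_eq0.
have DED : D *m E = D.
  apply/matrixP => i j; rewrite !mxE.
  have [ip|ip] := ltnP i p; last first.
    rewrite big1 => [|k _]; rewrite ?mxE.
      case: eqP => [ij|]; rewrite ?mulr0n ?mul0r //.
      by have := ltn_ord j; rewrite -ij ltnNge ip.
    case: eqP => [ij|]; rewrite ?mulr0n ?mul0r //.
    by have := ltn_ord k; rewrite -ij ltnNge ip.
  rewrite (bigD1 (Ordinal ip)) //= big1 ?addr0 => [|k ki]; rewrite !mxE /=; last first.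
    case: eqP => [ik|]; rewrite ?mulr0n ?mul0r //.
    by case/eqP: ki; apply: val_inj.
  have -> : (Ordinal ip == j) = (i == j :> nat) by [].
  rewrite ltn_ord eqxx mulr1n andTb; case: (i == j :> nat); rewrite ?mulr1n ?mulr0n ?mulr0 //.
  by have [->|d0] := eqVneq d`_i 0; rewrite ?mul0r ?mulr1.
have iF k l (X : 'M[int]_(k, l)) : integral (i2F k l X).
  by move=> i j; rewrite mxE intr_int.
have LF : i2F _ _ (invmx L) *m i2F _ _ L = 1%:M by rewrite -map_mxM mulVmx // map_mx1.
have RF : i2F _ _ R *m i2F _ _ (invmx R) = 1%:M by rewrite -map_mxM mulmxV // map_mx1.
have -> : map_mx intr (L *m (\matrix_(i, j) (d`_i *+ (i == j :> nat))) *m R) =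
          i2F _ _ L *m D *m i2F _ _ R.
  rewrite !map_mxM; congr (_ *m _ *m _); apply/matrixP => i j; rewrite !mxE.
  by case: eqP.
exists (i2F _ _ (invmx R) *m E *m i2F _ _ R); split.
- apply: integralM => //; apply: integralM => // i j.
  by rewrite mxE rpredMn // rpred_nat.
- by rewrite !mulmxA -[_ *m i2F _ _ R *m _]mulmxA RF mulmx1 -[_ *m D *m E]mulmxA DED.
- exists (i2F _ _ (invmx R) *m D' *m i2F _ _ (invmx L)).
  by rewrite !mulmxA -[_ *m i2F _ _ (invmx L) *m _]mulmxA LF mulmx1 -[_ *m D' *m D]mulmxA DE.
Qed.

End Cones2.

(** * Homogenization *)

Lemma IZR_int (z : Z) : IZR z \is a Num.int.
Proof.
have pos p : IZR (Zpos p) \is a Num.int by rewrite IZRposE INRE rpred_nat.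
case: z => [|p|p] //; first by rewrite R0E.
by rewrite -[Z.neg p]/(Z.opp (Z.pos p)) opp_IZR RoppE rpredN.
Qed.

Lemma int_IZR (x : R) : x \is a Num.int -> exists z, x = IZR z.
Proof.
move=> /intrP[[m|m] ->].
  by exists (Z.of_nat m); rewrite -INR_IZR_INZ INRE.
by exists (Z.opp (Z.of_nat m.+1)); rewrite opp_IZR -INR_IZR_INZ INRE NegzE mulrNz.
Qed.

Definition colv m (a : 'I_m -> R) : 'cV[R]_m := \col_i a i.
Definition rowv m (x : 'I_m -> R) : 'rV[R]_m := \row_i x i.

Lemma dotE m (a x : 'I_m -> R) : dot a x = ev (colv a) (rowv x).
Proof.
rewrite /dot -[Rplus]/(@GRing.add R) foldrE big_map big_enum /ev mxE /=.
by apply: eq_bigr => i _; rewrite !mxE mulrC.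
Qed.

Lemma rowvK m (f : 'rV[R]_m) : rowv (fun i => f 0 i) = f.
Proof. by apply/rowP => i; rewrite mxE. Qed.

Lemma is_int_vecE m (x : 'I_m -> R) : is_int_vec x <-> integral (rowv x).
Proof.
split=> [xi i j|xi i]; first by rewrite mxE; have [z ->] := xi j; apply: IZR_int.
by apply: int_IZR; have := xi 0 i; rewrite mxE.
Qed.

Section Homogenization.
Context {p q : nat}.
Implicit Types (z : pt p q).

(* The point [(x, y)] is encoded by the row [(x, y, 1)], and the affine functional
   [a x + b y - g] by the column [(a, b, -g)], so that polyhedra become cones. *)
Definition hom z : 'rV[R]_(p + (q + 1)) := row_mx (rowv z.1) (row_mx (rowv z.2) 1%:M).
Definition tcol : 'cV[R]_(p + (q + 1)) := col_mx 0 (col_mx 0 1%:M).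
Definition xproj : 'M[R]_(p + (q + 1), p) := col_mx 1%:M 0.
Definition affine (a : 'I_p -> R) (b : 'I_q -> R) (g : R) : 'cV[R]_(p + (q + 1)) :=
  col_mx (colv a) (col_mx (colv b) (- g)%:M).

Lemma ev_affine a b g z : ev (affine a b g) (hom z) = lin a b z - g.
Proof.
rewrite /lin !dotE /ev /affine /hom !mul_row_col mul1mx !mxE addrA.
by rewrite eqxx mulr1n.
Qed.

Lemma affineK f : exists a b g, f = affine a b g.
Proof.
exists (fun i => f (lshift _ i) 0), (fun j => f (rshift _ (lshift _ j)) 0),
  (- f (rshift _ (rshift _ 0)) 0).
rewrite -[LHS](vsubmxK f) -[dsubmx f]vsubmxK; congr (col_mx _ (col_mx _ _));
  apply/colP => i; rewrite !mxE //.
by rewrite !ord1 opprK eqxx mulr1n.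
Qed.

Lemma tcol_hom z : ev tcol (hom z) = 1.
Proof. by rewrite /ev !mul_row_col !mulmx0 !add0r mul1mx mxE. Qed.

Lemma xproj_hom z : hom z *m xproj = rowv z.1.
Proof. by rewrite mul_row_col mulmx1 mulmx0 addr0. Qed.

Lemma homP w : ev tcol w = 1 -> exists z, w = hom z.
Proof.
rewrite -[w]hsubmxK -[rsubmx w]hsubmxK /ev !mul_row_col !mulmx0 !add0r mulmx1 => w1.
exists ((fun i => lsubmx w 0 i), (fun j => lsubmx (rsubmx w) 0 j)).
rewrite /hom !rowvK; congr (row_mx _ (row_mx _ _)).
by apply/rowP => i; rewrite !ord1 w1 mxE.
Qed.

Lemma integral_tcol : integral tcol.
Proof. by do 2?[apply: integral_col_mx; first exact: integral0]; apply: integral1. Qed.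

Lemma integral_xproj : integral xproj.
Proof. by apply: integral_col_mx; [apply: integral1|apply: integral0]. Qed.

(** Convex combinations without normalization: [conv] is the slice [tcol = 1] of this cone, and
    inductions may pass through any height. *)
Definition hull (S : pt p q -> Prop) w := exists l : seq (R * pt p q),
  (forall u, In u l -> 0 <= u.1 /\ S u.2) /\ w = \sum_(u <- l) u.1 *: hom u.2.

Lemma wsumE (A : Type) (l : seq (R * A)) (f : A -> R) :
  wsum l f = \sum_(u <- l) u.1 * f u.2.
Proof. by elim: l => [|u l IH]; rewrite ?big_nil // big_cons /= IH. Qed.

Lemma wtotalE (A : Type) (l : seq (R * A)) : wtotal l = \sum_(u <- l) u.1.
Proof. by elim: l => [|u l IH]; rewrite ?big_nil // big_cons /= IH. Qed.

Lemma convE S z : conv S z <-> hull S (hom z).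
Proof.
have sumE l : \sum_(u <- l) u.1 *: hom u.2 =
    row_mx (rowv (fun i => wsum l (fun u => u.1 i)))
      (row_mx (rowv (fun j => wsum l (fun u => u.2 j))) (wtotal l)%:M).
  elim: l => [|u l IH].
    rewrite big_nil; apply/rowP => j; rewrite !mxE; case: split => // {}j; rewrite !mxE //.
    by case: split => {}j; rewrite !mxE // !ord1 eqxx.
  rewrite big_cons IH /hom !scale_row_mx !add_row_mx scalemx1 -raddfD /=.
  by congr (row_mx _ (row_mx _ _)); apply/rowP => i; rewrite !mxE.
split=> -[l [lS]].
  move=> [l1 [zx zy]]; exists l; split; first by move=> u /lS[/RleP].
  rewrite sumE l1; congr (row_mx _ (row_mx _ _)); apply/rowP => i; rewrite !mxE //.
rewrite sumE => /eq_row_mx[zx /eq_row_mx[zy zt]]; exists l; split; last split; last split.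
- by move=> u /lS[/RleP].
- by move/matrixP/(_ 0 0): zt; rewrite !mxE.
- by move=> i; move/matrixP/(_ 0 i): zx; rewrite !mxE.
- by move=> i; move/matrixP/(_ 0 i): zy; rewrite !mxE.
Qed.

Lemma hull_mem (S : pt p q -> Prop) z : S z -> hull S (hom z).
Proof.
move=> Sz; exists [:: (1, z)]; split=> [u [<-|//]|]; first by rewrite /= ler01.
by rewrite big_seq1 scale1r.
Qed.

Lemma hull0 (S : pt p q -> Prop) : hull S 0.
Proof. by exists [::]; rewrite big_nil; split. Qed.

Lemma hullD (S : pt p q -> Prop) x y : hull S x -> hull S y -> hull S (x + y).
Proof.
move=> [l [lS ->]] [r [rS ->]]; exists (l ++ r); rewrite big_cat; split=> // u.
by case/(in_app_or l) => [/lS|/rS].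
Qed.

Lemma hullZ (S : pt p q -> Prop) a x : 0 <= a -> hull S x -> hull S (a *: x).
Proof.
move=> a0 [l [lS ->]]; exists [seq (a * u.1, u.2) | u <- l]; split.
  by move=> u /in_map_iff[v [<- /lS[v0 Sv]]] /=; rewrite mulr_ge0.
by rewrite big_map scaler_sumr; apply: eq_bigr => u _; rewrite scalerA.
Qed.

Lemma hull_min (S : pt p q -> Prop) (K : 'rV[R]_(p + (q + 1)) -> Prop) w :
  K 0 -> (forall x y, K x -> K y -> K (x + y)) ->
  (forall t z, 0 <= t -> S z -> K (t *: hom z)) -> hull S w -> K w.
Proof.
move=> K0 KD KS [l [lS ->]]; elim: l lS => [|u l IH] lS; first by rewrite big_nil.
rewrite big_cons; apply: KD; last by apply: IH => v vl; apply: lS; right.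
by have [|u0 Su] := lS u; [left|apply: KS].
Qed.

Lemma ev_hull (S : pt p q -> Prop) f w :
  (forall z, S z -> ev f (hom z) <= 0) -> hull S w -> ev f w <= 0.
Proof.
move=> fS; apply: (hull_min (K := fun w => ev f w <= 0)) => [|x y|t z t0 /fS fz].
- by rewrite ev0.
- by rewrite evD; lra.
- by rewrite evZ mulr_ge0_le0.
Qed.

End Homogenization.

(** * Disjunctive closures *)

Section Closure.
Context {k p q : nat}.
Implicit Types (z : pt p q) (C : pt p q -> Prop).

Lemma closure_mono C C' : (forall z, C z -> C' z) ->
  forall z, kdisj_closure k C z -> kdisj_closure k C' z.
Proof.
move=> CC' z [Cz zcut]; split; first exact: CC'.
move=> a b g [_ [d [delta [dd cut]]]].
(* A cut must be violated somewhere, which may fail on the smaller set; here [z] itself is the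
   violating point. *)
have [//|zg] := Rle_or_lt (lin a b z) g.
apply: zcut; split; first by exists z.
by exists d, delta; split=> // x /CC'; apply: cut.
Qed.

Lemma rank_mono C C' n : (forall z, C z -> C' z) ->
  forall z, kdisj_rank k C n z -> kdisj_rank k C' n z.
Proof. by move=> CC'; elim: n => //= n; apply: closure_mono. Qed.

Lemma rank_le C m n z : (m <= n)%N -> kdisj_rank k C n z -> kdisj_rank k C m z.
Proof. by elim: n => [|n IH]; rewrite leq_eqVlt => /predU1P[->|] // /IH mn [/mn]. Qed.

Lemma integer_hull_rank C n z :
  (forall z, integer_hull C z -> C z) -> integer_hull C z -> kdisj_rank k C n z.
Proof.
move=> hullC; elim: n z => [|n IH] z; first exact: hullC.
move=> zC; split=> [|a b g [_ [d [delta [dd cut]]]]]; first exact: IH.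
apply/RleP; rewrite -subr_le0 -ev_affine; move/convE: zC; apply: ev_hull => x [Cx xi].
rewrite ev_affine subr_le0; apply/RleP.
have [//|gx] := Rle_or_lt (lin a b x) g; have [i di] := dd _ xi.
have Hx : kdisj_rank k C n x by apply/IH/convE/hull_mem.
by have := cut x Hx gx i; move/(Rlt_not_le _ _).
Qed.

Definition reach C (f : 'cV[R]_(p + (q + 1))) :=
  exists n, forall z, kdisj_rank k C n z -> ev f (hom z) <= 0.

Lemma reach_mono C C' f : (forall z, C z -> C' z) -> reach C' f -> reach C f.
Proof. by move=> CC' [n fn]; exists n => z /(rank_mono CC') /fn. Qed.

Lemma reach_valid C f : (forall z, C z -> ev f (hom z) <= 0) -> reach C f.
Proof. by exists 0%N. Qed.

Lemma reachD C f g : reach C f -> reach C g -> reach C (f + g).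
Proof.
move=> [m fm] [n gn]; exists (maxn m n) => z zC; rewrite evDl.
have := fm z (rank_le (leq_maxl m n) zC); have := gn z (rank_le (leq_maxr m n) zC); lra.
Qed.

Lemma reachZ C a f : 0 <= a -> reach C f -> reach C (a *: f).
Proof. by move=> a0 [n fn]; exists n => z /fn fz; rewrite evZl mulr_ge0_le0. Qed.

Lemma reach_le C f g : (forall z, C z -> ev g (hom z) <= ev f (hom z)) ->
  reach C f -> reach C g.
Proof.
by move=> gf [n fn]; exists n => z zC; apply: le_trans (fn z zC); apply/gf/(rank_le (leq0n n) zC).
Qed.

Lemma reach_at C f z :
  (forall z, integer_hull C z -> C z) -> integer_hull C z -> reach C f -> ev f (hom z) <= 0.
Proof. by move=> hullC zC [n]; apply; apply: integer_hull_rank. Qed.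

Lemma reach_seq C (H : seq 'cV[R]_(p + (q + 1))) : (forall h, h \in H -> reach C h) ->
  exists n, forall z, kdisj_rank k C n z -> forall h, h \in H -> ev h (hom z) <= 0.
Proof.
elim: H => [|h H IH] HC; first by exists 0%N.
have [m hm] : reach C h by apply: HC; rewrite inE eqxx.
have [|n Hn] := IH; first by move=> h' h'H; apply: HC; rewrite inE h'H orbT.
exists (maxn m n) => z zC h'; rewrite inE => /predU1P[->|].
  exact: hm _ (rank_le (leq_maxl m n) zC).
exact: Hn _ (rank_le (leq_maxr m n) zC) _.
Qed.

Lemma reach_cut C f n (D : 'I_k -> 'cV[R]_p) (e : 'I_k -> R) :
  (forall i, integral (D i)) -> (forall i, e i \is a Num.int) ->
  (forall x, integral x -> exists i, ev (D i) x <= e i) ->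
  (forall z, kdisj_rank k C n z -> 0 < ev f (hom z) ->
     forall i, e i < ev (D i) (hom z *m xproj)) ->
  reach C f.
Proof.
move=> Di ei disj cut; have [a [b [g fE]]] := affineK f; subst f.
have /fin_all_exists [delta deltaE] i : exists m, e i = IZR m by apply: int_IZR.
have /fin_all_exists [d dE] i : exists m : 'I_p -> Z, forall j, D i j 0 = IZR (m j).
  by have [m mE] := fin_all_exists (fun j => int_IZR (Di i j 0)); exists m.
have dvecE i : colv (dvec d i) = D i by apply/colP => j; rewrite mxE dE.
exists n.+1 => z [zC zcut]; rewrite ev_affine subr_le0; apply/RleP.
have [//|gz] := Rle_or_lt (lin a b z) g.
apply: zcut; split; first by exists z.
exists d, delta; split=> [x /is_int_vecE /disj[i xi]|x Cx /RltP gx i].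
  by exists i; rewrite dotE dvecE -deltaE; apply/RleP.
apply/RltP; rewrite dotE dvecE -deltaE -xproj_hom; apply: cut => //.
by rewrite ev_affine subr_gt0.
Qed.

Lemma reach_split C f n (s : 'cV[R]_p) (j : R) : (2 <= k)%N ->
  integral s -> j \is a Num.int ->
  (forall z, kdisj_rank k C n z -> 0 < ev f (hom z) ->
     j < ev s (hom z *m xproj) < j + 1) ->
  reach C f.
Proof.
move=> k2 si ji cut.
(* All indices other than 0 repeat the second side of the split. *)
pose D (i : 'I_k) := if (i == 0%N :> nat) then s else - s.
pose e (i : 'I_k) := if (i == 0%N :> nat) then j else - (j + 1).
apply: (@reach_cut C f n D e).
- by move=> i; rewrite /D; case: ifP => // _; apply: integralN.
- by move=> i; rewrite /e; case: ifP => // _; rewrite rpredN rpredD ?rpred1.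
- move=> x xi; have [xj|xj] := leP (ev s x) j.
    by exists (Ordinal (ltnW k2)); rewrite /D /e eqxx.
  exists (Ordinal k2); rewrite /D /e /= evNl lerN2.
  have : ev s x - j \is a Num.int by rewrite rpredB // integral_ev.
  move=> /intrP[m sm]; have : (0 : R) < m%:~R by rewrite -sm subr_gt0.
  by rewrite ltr0z gtz0_ge1 -(ler1z R) -sm; lra.
- by move=> z zC /(cut z zC) /andP[j1 j2] i; rewrite /D /e; case: ifP => _; rewrite ?evNl; lra.
Qed.

End Closure.
Arguments reach k {p q}.

(** * Meyer's theorem *)

Lemma Q2R_denominator (x : Q) : exists d : nat, (0 < d)%N /\ d%:R * Q2R x \is a Num.int.
Proof.
exists (nat_of_pos (Qden x)); rewrite -Pos_to_natE; split; first exact/ssrnat.ltP/Pos2Nat.is_pos.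
rewrite Pos_to_natE /Q2R RmultE RinvE IZRposE INRE mulrCA mulfV ?mulr1; first exact: IZR_int.
by rewrite pnatr_eq0 -lt0n -Pos_to_natE; apply/ssrnat.ltP/Pos2Nat.is_pos.
Qed.

Lemma clear_denominators m n (A : 'M[R]_(m, n)) :
  (forall i j, exists d : nat, (0 < d)%N /\ d%:R * A i j \is a Num.int) ->
  exists d : nat, (0 < d)%N /\ integral (d%:R *: A).
Proof.
move=> dA; have [d dP] : exists d : 'I_m * 'I_n -> nat, forall ij,
    (0 < d ij)%N /\ (d ij)%:R * A ij.1 ij.2 \is a Num.int.
  exact: (fin_all_exists (fun ij : 'I_m * 'I_n => dA ij.1 ij.2)).
exists (\prod_ij d ij)%N; split; first by apply: prodn_gt0 => ij; case: (dP ij).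
move=> i j; rewrite mxE (bigD1 (i, j)) //= natrM mulrAC.
by rewrite rpredM ?rpred_nat //; case: (dP (i, j)).
Qed.

Section Meyer.
Context {p q : nat}.
Implicit Types (z : pt p q) (G : seq 'rV[R]_(p + (q + 1))) (w : 'rV[R]_(p + (q + 1))).

Lemma rat_polyhedron_halfspaces cs : exists H : seq 'cV[R]_(p + (q + 1)),
  (forall h, h \in H -> integral h) /\
  forall z, rat_polyhedron cs z <-> forall h, h \in H -> ev h (hom z) <= 0.
Proof.
elim: cs => [|c cs [H [Hi HP]]]; first by exists [::]; split=> // z; split=> [_ h|_ c []].
pose f := affine (fun i => Q2R (c.1.1 i)) (fun j => Q2R (c.1.2 j)) (Q2R c.2).
have [|d [d0 fi]] := @clear_denominators _ _ f.
  move=> i j; rewrite /f /affine mxE; case: split => {}i.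
    by rewrite mxE; apply: Q2R_denominator.
  rewrite mxE; case: split => {}i; first by rewrite mxE; apply: Q2R_denominator.
  have [d [d0 di]] := Q2R_denominator c.2; exists d; split=> //.
  by rewrite mxE !ord1 eqxx mulr1n mulrN rpredN.
exists (d%:R *: f :: H); split=> [h|z].
  by rewrite inE => /predU1P[->|/Hi].
have fP : ev (d%:R *: f) (hom z) <= 0 <->
    Rle (lin (fun i => Q2R (c.1.1 i)) (fun j => Q2R (c.1.2 j)) z) (Q2R c.2).
  by rewrite evZl pmulr_rle0 ?ltr0n // ev_affine subr_le0; split=> /RleP.
split=> [zP h|zH c'].
  rewrite inE => /predU1P[->|]; first by apply/fP/zP; left.
  by move: h; apply/HP => c' c'cs; apply: zP; right.
case=> [<-|]; first by apply/fP/zH; rewrite inE eqxx.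
by apply: (proj2 (HP z)) => h hH; apply: zH; rewrite inE hH orbT.
Qed.

Lemma rat_polyhedron_cone cs : exists G,
  [/\ forall g, g \in G -> integral g, forall g, g \in G -> 0 <= ev tcol g &
      forall z, rat_polyhedron cs z <-> cone G (hom z)].
Proof.
have [H [Hi HP]] := rat_polyhedron_halfspaces cs.
have [G [GP Gi]] := minkowski (- tcol :: H).
exists G; split=> [|g /cone_mem/GP/(_ (- tcol))|z].
- by apply: Gi => h; rewrite inE => /predU1P[->|/Hi//]; apply/integralN/integral_tcol.
- by rewrite inE eqxx evNl => /(_ isT); lra.
rewrite HP -GP; split=> zH h; last by move=> hH; apply: zH; rewrite inE hH orbT.
by rewrite inE => /predU1P[->|/zH//]; rewrite evNl tcol_hom; lra.
Qed.

Definition rays G := [seq g <- G | ev tcol g == 0].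

Lemma tcol_rays G u : cone (rays G) u -> ev tcol u = 0.
Proof.
move=> uG; apply/eqP; rewrite eq_le; apply/andP; split.
  by apply: ev_cone uG => g; rewrite mem_filter => /andP[/eqP -> _].
rewrite -oppr_le0 -evNl; apply: ev_cone uG => g.
by rewrite mem_filter evNl => /andP[/eqP -> _]; rewrite oppr0.
Qed.

Lemma tcol_cone G w : (forall g, g \in G -> 0 <= ev tcol g) -> cone G w -> 0 <= ev tcol w.
Proof.
by move=> G0 wG; rewrite -oppr_le0 -evNl; apply: ev_cone wG => g /G0; rewrite evNl oppr_le0.
Qed.

Lemma row_bound n (x : 'rV[R]_n) : exists B : nat, forall i, `|x 0 i| <= B%:R.
Proof.
have [t [_ ub _]] := nonneg_ub (enum 'I_n) (fun i => `|x 0 i|).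
by have [B tB] := nat_ub t; exists B => i; apply: le_trans tB; apply: ub; rewrite mem_enum.
Qed.

(** The integer part of each ray coefficient goes to [u]. Other generators have height at least 1 by
    integrality, so their coefficients are bounded by the height of [w]; the 1 in the bound pays for
    the fractional parts. *)
Lemma split_integral_ray G :
  (forall g, g \in G -> integral g) -> (forall g, g \in G -> 0 <= ev tcol g) ->
  exists B : nat, forall w, cone G w -> exists w' u,
    [/\ w = w' + u, cone G w', cone (rays G) u, integral u &
        forall i, `|(w' *m xproj) 0 i| <= B%:R * (1 + ev tcol w)].
Proof.
elim: G => [|g G IH] Gi G0.
  exists 0%N => w ->; exists 0, 0; rewrite addr0; split=> //; first exact: integral0.
  by move=> i; rewrite mul0mx mxE normr0 mul0r.
have [h hG|h hG|B HB] := IH; [by apply: Gi; rewrite inE hG orbT|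
  by apply: G0; rewrite inE hG orbT|].
have [Bg HBg] := row_bound (g *m xproj); exists (B + Bg)%N => w [t t0 wG].
have [w' [u [wE w'G uG ui w'B]]] := HB _ wG.
have gG : g \in g :: G by rewrite inE eqxx.
have GG : {subset G <= g :: G} by move=> h hG; rewrite inE hG orbT.
have w0 : 0 <= ev tcol (w - t *: g).
  by apply: tcol_cone wG => h hG; apply/G0/GG.
have rG : cone (rays (g :: G)) u.
  by apply: sub_cone uG => h; rewrite !mem_filter => /andP[-> /GG ->].
have bnd s i : 0 <= s -> `|((w' + s *: g) *m xproj) 0 i| <=
    B%:R * (1 + ev tcol (w - t *: g)) + s * Bg%:R.
  move=> s0; rewrite mulmxDl -scalemxAl !mxE; apply: le_trans (ler_normD _ _) _.
  apply: lerD => //; first by have := w'B i; rewrite !mxE.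
  by rewrite normrM ger0_norm // ler_wpM2l //; have := HBg i; rewrite mxE.
have g0 := G0 g gG; have B0 : 0 <= B%:R :> R by []; have Bg0 : 0 <= Bg%:R :> R by [].
move: bnd w0; rewrite !evE => bnd w0.
have [tg|tg] := eqVneq (ev tcol g) 0; last first.
  exists (w' + t *: g), u; split=> //.
  - by rewrite addrAC -wE subrK.
  - apply: coneD; first exact: sub_cone w'G.
    by apply: coneZ => //; apply: cone_mem.
  move=> i; apply: le_trans (bnd t i t0) _; rewrite natrD.
  have g1 : 1 <= ev tcol g.
    have /intrP[m mE] : ev tcol g \is a Num.int.
      by apply: integral_ev; [apply: integral_tcol|apply: Gi].
    have : 0 < ev tcol g by rewrite lt_neqAle eq_sym tg.
    by rewrite mE ltr0z gtz0_ge1 -(ler1z R).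
  have := ler_wpM2l t0 g1; have := mulr_ge0 t0 g0; nra.
have /andP[f1 f2] := floor_itv t; rewrite intrD mulr1z in f2.
exists (w' + (t - (Num.floor t)%:~R) *: g), (u + (Num.floor t)%:~R *: g); split.
- by rewrite -[LHS](subrK (t *: g)) wE addrACA -scalerDl subrK.
- apply: coneD; first exact: sub_cone w'G.
  by apply: coneZ; [lra|apply: cone_mem].
- apply: coneD => //; apply: coneZ; first by rewrite ler0z floor_ge0.
  by apply: cone_mem; rewrite mem_filter tg eqxx.
- by apply: integralD => //; apply: integralZ; [apply: intr_int|apply: Gi].
move=> i; have := bnd (t - (Num.floor t)%:~R) i; rewrite subr_ge0 => /(_ f1) bi.
apply: le_trans bi _; rewrite tg in w0 *; rewrite natrD; nra.
Qed.

Lemma integer_box n (B : nat) : exists X : seq 'rV[R]_n,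
  (forall x, x \in X -> integral x) /\
  forall x, integral x -> (forall i, `|x 0 i| <= B%:R) -> x \in X.
Proof.
pose row_of (f : {ffun 'I_n -> 'I_(B + B).+1}) : 'rV[R]_n := \row_i ((f i : nat)%:R - B%:R).
exists [seq row_of f | f : {ffun 'I_n -> 'I_(B + B).+1}]; split=> [_ /imageP[f _ ->]|x xi xB].
  by move=> i j; rewrite mxE rpredB // rpred_nat.
have /fin_all_exists[f fE] i : exists m : 'I_(B + B).+1, x 0 i = (m : nat)%:R - B%:R.
  have /intrP[m mE] : x 0 i + B%:R \is a Num.int by rewrite rpredD // rpred_nat.
  have := xB i; rewrite ler_norml => /andP[x1 x2].
  have m0 : (0 : R) <= m%:~R by rewrite -mE -lerBlDr sub0r.
  rewrite ler0z in m0; case: m mE m0 => [m|//] mE _.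
  have {}mE : x 0 i + B%:R = m%:R by rewrite mE -pmulrn.
  have mB : (m < (B + B).+1)%N by rewrite ltnS -(ler_nat R) natrD -mE; lra.
  by exists (Ordinal mB); rewrite /= -mE addrK.
apply/imageP; exists (finfun f) => //; apply/rowP => i.
by rewrite mxE ffunE fE.
Qed.

(** A fiber is an intersection: [weyl] gives half-spaces, to which the equations of the fiber are
    added, and [minkowski] returns to generators. *)
Lemma fiber_cone G (x : 'rV[R]_p) : (forall g, g \in G -> integral g) -> integral x ->
  exists G', (forall g, g \in G' -> integral g) /\
    forall w, cone G' w <-> cone G w /\ w *m xproj = ev tcol w *: x.
Proof.
move=> Gi xi; have [H [HP Hi]] := weyl G.
pose f i := xproj *m delta_mx i 0 - x 0 i *: tcol : 'cV[R]_(p + (q + 1)).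
have fE i w : ev (f i) w = (w *m xproj) 0 i - x 0 i * ev tcol w.
  by rewrite !evE -ev_mul ev_delta.
have fi i : integral (f i).
  apply: integralD; first by apply: integralM; [apply: integral_xproj|apply: integral_delta].
  by apply/integralN/integralZ => //; apply: integral_tcol.
have [G' [G'P G'i]] := minkowski (H ++ [seq f i | i <- enum 'I_p] ++ [seq - f i | i <- enum 'I_p]).
exists G'; split.
  apply: G'i => h; rewrite !mem_cat => /or3P[hH|/mapP[i _ ->]|/mapP[i _ ->]] //.
    exact: Hi.
  exact: integralN.
move=> w; rewrite -G'P HP; split=> [wH|[wH wx] h].
  split=> [h hH|]; first by apply: wH; rewrite mem_cat hH.
  apply/rowP => i; rewrite [RHS]mxE.
  have := wH (f i); have := wH (- f i).
  rewrite !mem_cat (map_f f) ?mem_enum // (map_f (fun i => - f i)) ?mem_enum // !orbT.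
  by move=> /(_ isT) + /(_ isT); rewrite evNl fE; lra.
rewrite !mem_cat => /or3P[|/mapP[i _ ->]|/mapP[i _ ->]]; first exact: wH.
  by rewrite fE wx mxE mulrC subrr.
by rewrite evNl fE wx mxE mulrC subrr oppr0.
Qed.

Lemma fibers_cone G (X : seq 'rV[R]_p) :
  (forall g, g \in G -> integral g) -> (forall x, x \in X -> integral x) ->
  exists G', [/\ forall g, g \in G' -> integral g,
    forall g, g \in G' -> cone G g /\ exists2 x, integral x & g *m xproj = ev tcol g *: x &
    forall x w, x \in X -> cone G w -> w *m xproj = ev tcol w *: x -> cone G' w].
Proof.
move=> Gi; elim: X => [|x X IH] Xi; first by exists [::]; split.
have xi : integral x by apply: Xi; rewrite inE eqxx.
have [x' x'X|G1 [G1i G1X XG1]] := IH; first by apply: Xi; rewrite inE x'X orbT.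
have [G2 [G2i G2P]] := fiber_cone Gi xi.
exists (G2 ++ G1); split.
- by move=> g; rewrite mem_cat => /orP[/G2i|/G1i].
- move=> g; rewrite mem_cat => /orP[/cone_mem/G2P[gG gx]|/G1X//].
  by split=> //; exists x.
move=> x' w; rewrite inE => /predU1P[->|x'X] wG wx.
  by apply: (@sub_cone _ _ G2) => [g|]; [rewrite mem_cat => ->|apply/G2P].
apply: (@sub_cone _ _ G1) => [g|]; first by rewrite mem_cat orbC => ->.
exact: XG1 x'X wG wx.
Qed.

(** [S] is stable only under natural multiples of [r]. Moving every point of a combination by [N r]
    moves [s] by [N] times its height, and [s + t r] lies between [s] and the result. *)
Lemma hull_ray (S : pt p q -> Prop) r s :
  ev tcol r = 0 -> (forall (N : nat) z, S z -> exists2 z', S z' & hom z' = hom z + N%:R *: r) ->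
  forall t, 0 <= t -> hull S s -> 0 < ev tcol s -> hull S (s + t *: r).
Proof.
move=> r0 Sr t t0 sS s0; have [N tN] := nat_ub (t / ev tcol s).
have sN : hull S (s + (ev tcol s * N%:R) *: r).
  move: sS; apply: (hull_min (K := fun s => hull S (s + (ev tcol s * N%:R) *: r))).
  - by rewrite ev0 mul0r scale0r addr0; apply: hull0.
  - by move=> x y xS yS; rewrite evD mulrDl scalerDl addrACA; apply: hullD.
  - move=> a z a0 Sz; rewrite evZ tcol_hom mulr1 -scalerA -scalerDr.
    by have [z' Sz' <-] := Sr N z Sz; apply/hullZ/hull_mem.
rewrite ler_pdivrMr // in tN; pose D := ev tcol s * N%:R.
have [D0|D0] := eqVneq D 0.
  have -> : t = 0 by apply/eqP; rewrite eq_le t0 andbT -D0 /D mulrC.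
  by rewrite scale0r addr0.
have Dp : 0 < D by rewrite lt_neqAle eq_sym D0 mulr_ge0 // ltW.
have -> : s + t *: r = (1 - t / D) *: s + (t / D) *: (s + D *: r).
  by rewrite scalerDr scalerA divfK // addrA -scalerDl subrK scale1r.
by apply: hullD; apply: hullZ;
  rewrite ?subr_ge0 ?ler_pdivrMr ?mul1r ?divr_ge0 // ?(ltW Dp) // /D mulrC.
Qed.

(* Meyer's theorem: modulo integral combinations of the rays, a mixed-integer
   point of [P] has its integral part in a finite box. *)
Lemma meyer (P : pt p q -> Prop) G :
  (forall g, g \in G -> integral g) -> (forall g, g \in G -> 0 <= ev tcol g) ->
  (forall z, P z <-> cone G (hom z)) ->
  exists GI, [/\ forall g, g \in GI -> integral g, forall g, g \in GI -> 0 <= ev tcol g &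
    forall z, integer_hull P z <-> cone GI (hom z)].
Proof.
move=> Gi G0 GP; have [B HB] := split_integral_ray Gi G0.
have [X [Xi XB]] := integer_box p (B + B).
have [GX [GXi GXG XGX]] := fibers_cone Gi Xi.
have raysi r : r \in rays G -> integral r by rewrite mem_filter => /andP[_ /Gi].
exists (GX ++ rays G); split.
- by move=> g; rewrite mem_cat => /orP[/GXi|/raysi].
- move=> g; rewrite mem_cat => /orP[/GXG[gG _]|]; first exact: tcol_cone gG.
  by rewrite mem_filter => /andP[/eqP -> _].
move=> z; rewrite /integer_hull convE; split.
  apply: hull_min; [exact: cone0|by move=> *; apply: coneD|].
  move=> {z} t z t0 [/GP/HB[w' [u [zE w'G uG ui w'B]]] /is_int_vecE zi].
  apply: coneZ => //; rewrite zE; apply: coneD; last first.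
    by apply: sub_cone uG => g; rewrite mem_cat orbC => ->.
  have w'1 : ev tcol w' = 1 by rewrite -(tcol_hom z) zE evD (tcol_rays uG) addr0.
  apply: (@sub_cone _ _ GX) => [g|]; first by rewrite mem_cat => ->.
  apply: (XGX (w' *m xproj)) => //; last by rewrite w'1 scale1r.
  apply: XB => [|i]; last first.
    by apply: le_trans (w'B i) _; rewrite tcol_hom natrD; lra.
  have -> : w' *m xproj = rowv z.1 - u *m xproj by rewrite -xproj_hom zE mulmxDl addrK.
  by apply: integralD => //; apply/integralN/integralM => //; apply: integral_xproj.
set S := fun z => _ => zG.
(* Generators of positive height rescale to mixed-integer points of [P]; those of height 0 are
   collected in [r]. *)
have [a [r [zE aS rG]]] : exists a r, [/\ hom z = a + r, hull S a & cone (rays G) r].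
  move: zG; apply: (cone_min (K := fun w =>
    exists a r, [/\ w = a + r, hull S a & cone (rays G) r])).
  - by exists 0, 0; rewrite addr0; split=> //; [apply: hull0|apply: cone0].
  - move=> x y [a [r [-> aS rG]]] [b [s [-> bS sG]]]; exists (a + b), (r + s).
    by rewrite addrACA; split=> //; [apply: hullD|apply: coneD].
  move=> t g t0; rewrite mem_cat => /orP[/GXG[gG [x xi gx]]|gG]; last first.
    exists 0, (t *: g); rewrite add0r; split=> //; first exact: hull0.
    by apply: coneZ => //; apply: cone_mem.
  have [g0|g0] := eqVneq (ev tcol g) 0.
    exists 0, (t *: g); rewrite add0r; split=> //; first exact: hull0.
    apply: coneZ => //; have : cone [seq g <- G | ev (- tcol) g == 0] g.
      by apply: cone_face => // [h /G0|]; rewrite evNl ?g0 ?oppr0 // oppr_le0.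
    by apply: sub_cone => h; rewrite !mem_filter evNl oppr_eq0.
  have gp : 0 < ev tcol g by rewrite lt_neqAle eq_sym g0 (tcol_cone G0 gG).
  have [|y gy] := @homP p q ((ev tcol g)^-1 *: g); first by rewrite evZ mulVf.
  exists (t *: g), 0; rewrite addr0; split=> //; last exact: cone0.
  have -> : t *: g = (t * ev tcol g) *: hom y by rewrite -gy scalerA mulfK.
  apply: hullZ; first by rewrite mulr_ge0 // ltW.
  apply: hull_mem; split; first by apply/GP; rewrite -gy; apply: coneZ => //; rewrite invr_ge0 ltW.
  by apply/is_int_vecE; rewrite -xproj_hom -gy -scalemxAl gx scalerA mulVf // scale1r.
have a1 : ev tcol a = 1 by rewrite -(tcol_hom z) zE evD (tcol_rays rG) addr0.
(* Rays are absorbed one at a time. Positive height is required because 0 lies in the hull without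
   representing any point to translate. *)
rewrite zE; suff : 0 <= ev tcol r /\ (forall a, hull S a -> 0 < ev tcol a -> hull S (a + r)).
  by move=> [_]; apply=> //; rewrite a1 ltr01.
move: rG; apply: (cone_min (K := fun r => 0 <= ev tcol r /\
  (forall a, hull S a -> 0 < ev tcol a -> hull S (a + r)))).
- by split; [rewrite ev0|move=> b; rewrite addr0].
- move=> x y [x0 xS] [y0 yS]; split=> [|b bS b0]; first by rewrite evD addr_ge0.
  by rewrite addrA; apply: yS; [apply: xS|rewrite evD; lra].
move=> t g t0; rewrite mem_filter => /andP[/eqP g0 gG].
split=> [|b bS b0]; first by rewrite evZ g0 mulr0.
apply: hull_ray => // N y [/GP Py /is_int_vecE yi].
have [|y' y'E] := @homP p q (hom y + N%:R *: g); first by rewrite !evE tcol_hom g0; lra.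
exists y' => //; split.
  by apply/GP; rewrite -y'E; apply: coneD => //; apply: coneZ => //; apply: cone_mem.
apply/is_int_vecE; rewrite -xproj_hom -y'E mulmxDl xproj_hom -scalemxAl.
apply: integralD => //; apply: integralZ; first exact: rpred_nat.
by apply: integralM; [apply: Gi|apply: integral_xproj].
Qed.

End Meyer.

(** * Approximation by split cuts *)

Section Lexicographic.
Context {k p q : nat}.
Variables (C : pt p q -> Prop) (z0 : pt p q).
Hypotheses (hullC : forall z, integer_hull C z -> C z) (z0C : integer_hull C z0).
Local Notation reach := (reach k C).
Local Notation functional := ('cV[R]_(p + (q + 1))).
Implicit Types (f g w t : functional) (fs : seq functional) (e : R).

Lemma reach_const e : e <= 0 -> reach (e *: tcol).
Proof. by move=> e0; apply: reach_valid => z _; rewrite evZl tcol_hom mulr1. Qed.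

Lemma reach_shift f e : 0 <= e -> reach (f + e *: tcol) -> reach f.
Proof. by move=> e0; apply: reach_le => z _; rewrite evDl evZl tcol_hom; lra. Qed.

(* [lex fs] with [fs = f_n :: ... :: f_0]: with respect to the sets of points
   [f_0 >= 0, ..., f_(i-1) >= 0], the supremum of [f_i] is asymptotically [0].
   This is expressed through the multipliers [t] in the cone spanned by
   [f_0, ..., f_(i-1)]. *)
Fixpoint lex fs : Prop := if fs is f :: fs' then
    [/\ lex fs',
        forall e, 0 < e -> exists2 t, cone fs' t & reach (f + t - e *: tcol) &
        forall t e, cone fs' t -> 0 < e -> ~ reach (f + t + e *: tcol)]
  else True.

(** If the newest multiplier is positive, dividing by it contradicts the third clause of [lex]; if
    it is 0, induction applies. The constant left at the bottom is refuted at [z0]. *)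
Lemma lex_gt0 fs t e : lex fs -> cone fs t -> 0 < e -> ~ reach (t + e *: tcol).
Proof.
elim: fs t e => [|f fs IH] t e /=.
  move=> _ -> e0 /(reach_at hullC z0C); rewrite add0r evZl tcol_hom; lra.
move=> [fsl _ fl] [m m0 tm] e0 tr; have [mE|mN] := eqVneq m 0.
  by move: tm; rewrite mE scale0r subr0 => /IH; apply; eauto.
have mp : 0 < m^-1 by rewrite invr_gt0 lt_neqAle eq_sym mN.
have tm' : cone fs (m^-1 *: (t - m *: f)) by apply: coneZ => //; apply: ltW.
apply: (fl _ (m^-1 * e) tm'); first exact: mulr_gt0.
move: (reachZ (ltW mp) tr); congr (reach _); apply/colP => i; rewrite !mxE; field.
exact: mN.
Qed.

(** Where all of [fs] are nonnegative they are asymptotically 0, so a combination falls below [e] at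
    the cost of further multipliers. *)
Lemma lex_approx fs t1 t2 e : lex fs -> cone fs t1 -> cone fs t2 -> 0 < e ->
  exists t, [/\ cone fs t, reach (t1 + t - e *: tcol) & reach (t2 + t - e *: tcol)].
Proof.
elim: fs t1 t2 e => [|f fs IH] t1 t2 e /=.
  move=> _ -> -> e0; exists 0; rewrite addr0 add0r -scaleNr.
  by split=> //; apply: reach_const; lra.
move=> [fsl fl _] [m1 m10 s1] [m2 m20 s2] e0.
have e20 : 0 < e / 2 by lra.
have top m : 0 <= m -> exists2 t, cone fs t & reach (m *: f + t - (e / 2) *: tcol).
  move=> m0; have [->|mN] := eqVneq m 0.
    exists 0; first exact: cone0.
    by rewrite scale0r add0r add0r -scaleNr; apply: reach_const; lra.
  have mp : 0 < m by rewrite lt_neqAle eq_sym mN.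
  have [|t tfs tr] := fl (m^-1 * (e / 2)); first by rewrite mulr_gt0 ?invr_gt0.
  exists (m *: t); first exact: coneZ.
  have := reachZ m0 tr; rewrite scalerBr scalerDr scalerA mulrA mulfV // mul1r.
  by [].
have [n1 n1fs n1r] := top _ m10; have [n2 n2fs n2r] := top _ m20.
(* The corrections [n1] and [n2] are crossed so that both sums receive the same [n1 + n2 + t]. *)
have [t [tfs t1r t2r]] := IH _ _ _ fsl (coneD s1 n2fs) (coneD s2 n1fs) e20.
have ee : e = e / 2 + e / 2 by lra.
exists (n1 + n2 + t); split.
- exists 0; rewrite // scale0r subr0; apply: coneD => //; exact: coneD.
- have := reachD n1r t1r; congr (reach _); apply/colP => i; rewrite !mxE; lra.
- have := reachD n2r t2r; congr (reach _); apply/colP => i; rewrite !mxE; lra.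
Qed.

(** [- c] is the supremum of the constants [e] for which some [w + t + e <= 0] is reached; the
    hypotheses make this set nonempty and bounded. *)
Lemma lex_extend fs w b : lex fs ->
  (exists t e, cone fs t /\ reach (w + t - e *: tcol)) ->
  (forall t e, cone fs t -> reach (w + t + e *: tcol) -> e <= b) ->
  exists c, lex (w - c *: tcol :: fs).
Proof.
move=> fsl [t0 [e0 [t0fs t0r]]] ub.
pose E e := exists2 t, cone fs t & reach (w + t + e *: tcol).
have [||m [mub mlub]] := completeness E.
- by exists b => e [t tfs tr]; apply/RleP/(ub _ _ tfs tr).
- by exists (- e0)%R, t0; rewrite // scaleNr.
exists (- m)%R; rewrite scaleNr opprK /=; split=> // [e e0'|t e tfs e0' tr].
  have [[x [t tfs tr] xm]|nE] := Classical_Prop.classic (exists2 x, E x & m - e < x).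
    exists t => //; apply: (@reach_shift _ (x - (m - e))%R); first lra.
    move: tr; congr (reach _); apply/colP => i; rewrite !mxE; lra.
  have : Rle m (m - e)%R.
    apply: mlub => x Ex; apply/RleP; rewrite leNgt; apply/negP => mx.
    by apply: nE; exists x.
  by move=> /RleP; lra.
suff /mub/RleP : E (m + e)%R by lra.
exists t => //; move: tr; congr (reach _); apply/colP => i; rewrite !mxE; lra.
Qed.

(** Were [c] fractional, the split between its floor [j] and [j + 1] would lower the asymptotic
    supremum of [w] by [e], against the last clause of [lex]. *)
Lemma lex_int fs (s : 'cV[R]_p) c : (2 <= k)%N -> integral s ->
  lex (xproj *m s - c *: tcol :: fs) -> c \is a Num.int.
Proof.
move=> k2 si [fsl wap wgt0]; apply/contraT => cN; exfalso.
have /andP[j1 j2] := floor_itv c; rewrite intrD mulr1z in j2.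
set w := xproj *m s in wap wgt0.
set j : R := (Num.floor c)%:~R in j1 j2.
have {}j1 : j < c by rewrite lt_neqAle j1 andbT; apply: contraNneq cN => <-; apply: intr_int.
(* [n] and [e] are half the distances from [c] to [j + 1] and to [j], so [2 n + 2 e = 1 <= N n]. On
   points violating the new inequality, [N t + t' <= e] excludes [w <= j], and [w - c + t <= n] with
   [t' <= e] excludes [w >= j + 1]. *)
pose n := (j + 1 - c) / 2; have n0 : 0 < n by rewrite /n; lra.
have [t tfs tr] := wap n n0.
have [N Nn] := nat_ub n^-1; have {}Nn : 1 <= N%:R * n by rewrite -ler_pdivrMr // mul1r.
pose e := (c - j) / 2; have e0 : 0 < e by rewrite /e; lra.
have [t' [t'fs r1 r2]] := lex_approx fsl (coneZ (ler0n _ N) tfs) (cone0 fs) e0.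
apply: (wgt0 (N%:R *: t + t') e); [exact: coneD (coneZ _ _) _|exact: e0|].
have [h|m HC] := @reach_seq k p q C [:: w - c *: tcol + t - n *: tcol;
    N%:R *: t + t' - e *: tcol; 0 + t' - e *: tcol].
  by rewrite !inE => /or3P[] /eqP ->.
apply: (@reach_split _ _ _ _ _ m s j) => //; first exact: intr_int.
move=> z zC; rewrite ev_mul -/w.
have := HC z zC; move=> Hz.
have := Hz (w - c *: tcol + t - n *: tcol); have := Hz (N%:R *: t + t' - e *: tcol).
have := Hz (0 + t' - e *: tcol); rewrite !inE !eqxx ?orbT.
move=> /(_ isT) + /(_ isT) + /(_ isT).
rewrite !evE tcol_hom.
set W := ev w _; set T := ev t _; set T' := ev t' _ => h3 h2 h1 h0.
have jc : c - j = 2 * e by rewrite /e; lra.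
have jn : j + 1 - c = 2 * n by rewrite /n; lra.
have N0 : 0 <= N%:R :> R by [].
apply/andP; split; rewrite ltNge; apply/negP => HW; first by lra.
have N1 : 1 <= N%:R :> R.
  rewrite ler1n lt0n; apply/negP => /eqP N0'; move: Nn; rewrite N0' mul0r; lra.
nra.
Qed.

End Lexicographic.

Lemma mulmx_sum_col m n (A : 'M[R]_(m, n)) (s : 'cV[R]_n) :
  A *m s = \sum_i s i 0 *: col i A.
Proof.
apply/colP => i; rewrite summxE mxE; apply: eq_bigr => j _.
by rewrite !mxE mulrC.
Qed.

(** * Valid inequalities up to a positive margin *)

Section Approximation.
Context {k p q : nat}.
Local Notation functional := ('cV[R]_(p + (q + 1))).
Implicit Types (G : seq 'rV[R]_(p + (q + 1))) (f : functional).

Definition polyhedron_of G (z : pt p q) := cone G (hom z).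

Lemma polyhedron_of_hull G z : integer_hull (polyhedron_of G) z -> polyhedron_of G z.
Proof.
move/convE; apply: hull_min; [exact: cone0|by move=> *; apply: coneD|].
by move=> t y t0 [yG _]; apply: coneZ.
Qed.

Lemma tilt_valid G f : (forall g, g \in G -> 0 <= ev tcol g) ->
  (forall g, g \in G -> ev tcol g = 0 -> ev f g <= 0) ->
  exists B : R, forall z, polyhedron_of G z -> ev (f - B *: tcol) (hom z) <= 0.
Proof.
move=> G0 Gf; have [|g|N HN] := @tilt _ _ G f (- tcol).
- by move=> g /G0; rewrite evNl oppr_le0.
- by rewrite evNl => gG /eqP; rewrite oppr_eq0 => /eqP; apply: Gf.
exists N%:R => z; apply: ev_cone => g /HN.
by rewrite !evE; lra.
Qed.

Lemma ray_le0 G f z0 g : polyhedron_of G z0 -> is_int_vec z0.1 ->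
  (forall z, polyhedron_of G z -> is_int_vec z.1 -> ev f (hom z) <= 0) ->
  g \in G -> integral g -> ev tcol g = 0 -> ev f g <= 0.
Proof.
move=> z0G /is_int_vecE z0i fP gG gi g0; rewrite leNgt; apply/negP => fg.
have [N HN] := nat_ub ((1 - ev f (hom z0)) / ev f g).
have [|z zE] := @homP p q (hom z0 + N%:R *: g); first by rewrite !evE tcol_hom g0; lra.
have : ev f (hom z) <= 0.
  apply: fP; first by rewrite /polyhedron_of -zE; apply: coneD => //; apply/coneZ/cone_mem.
  apply/is_int_vecE; rewrite -xproj_hom -zE mulmxDl xproj_hom -scalemxAl.
  apply: integralD => //; apply: integralZ; first exact: rpred_nat.
  by apply: integralM => //; apply: integral_xproj.
rewrite -zE !evE; rewrite ler_pdivrMr // in HN; lra.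
Qed.

(** Adding [N r] with [N >= t] makes a term [- t r] nonnegative; a natural [N] keeps the translation
    integral for integral rays. *)
Lemma cone_lineality G G0 z : {subset G0 <= G} ->
  cone (G ++ [seq - r | r <- G0]) z ->
  exists N : nat, cone G (z + N%:R *: \sum_(r <- G0) r).
Proof.
move=> G0G; have rhoG (s : seq 'rV[R]_(p + (q + 1))) :
    {subset s <= G} -> cone G (\sum_(r <- s) r).
  by move=> sG; rewrite big_seq; apply: cone_sum => r /sG; apply: cone_mem.
apply: (cone_min (K := fun z => exists N : nat,
  cone G (z + N%:R *: \sum_(r <- G0) r))) => [|x y [M xM] [N yN]|t g t0].
- by exists 0%N; rewrite scale0r addr0; apply: cone0.
- by exists (M + N)%N; rewrite natrD scalerDl addrACA; apply: coneD.
rewrite mem_cat => /orP[gG|/mapP[r rG0 ->]].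
  by exists 0%N; rewrite scale0r addr0; apply: coneZ => //; apply: cone_mem.
have [N tN] := nat_ub t; exists N.
rewrite (perm_big _ (perm_to_rem rG0)) big_cons /= scalerDr addrA scalerN addrC.
rewrite -scaleNr -scalerDl; apply: coneD; apply: coneZ => //.
- by apply: rhoG => s /mem_rem; apply: G0G.
- lra.
- exact/cone_mem/G0G.
Qed.

Lemma mem_cone_lin G G0 (I : Type) (r : seq I) (c : I -> R) (g : I -> 'rV[R]_(p + (q + 1))) :
  {subset G0 <= G} -> (forall i, g i \in G0) ->
  cone (G ++ [seq - r | r <- G0]) (\sum_(i <- r) c i *: g i).
Proof.
move=> G0G gG0; apply: cone_sum => i _.
have [ci|/ltW ci] := leP 0 (c i).
  by apply: coneZ => //; apply: cone_mem; rewrite mem_cat G0G.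
rewrite -[c i *: g i]opprK -scaleNr -scalerN; apply: coneZ; first lra.
by apply: cone_mem; rewrite mem_cat map_f ?orbT.
Qed.

(* Along the lineality space [L] spanned by the rays on which [f] vanishes, [P]
   may be replaced by [P + L]: this changes neither [f] nor, as the rays are
   integral, the bound on [f] over mixed-integer points.  The coordinates of
   [x - Pi x], where [Pi] is an integral projection onto [L], are then bounded
   on the level sets of [f], so that they can be fixed lexicographically at
   integer values. *)
Lemma reach_approx G f z0 e : (2 <= k)%N ->
  (forall g, g \in G -> integral g) -> (forall g, g \in G -> 0 <= ev tcol g) ->
  polyhedron_of G z0 -> is_int_vec z0.1 ->
  (forall z, polyhedron_of G z -> is_int_vec z.1 -> ev f (hom z) <= 0) ->
  0 < e -> reach k (polyhedron_of G) (f - e *: tcol).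
Proof.
move=> k2 Gi Gt z0G z0i fP e0.
pose G0 := [seq g <- rays G | ev f g == 0].
have G0P r : r \in G0 -> [/\ r \in G, ev tcol r = 0 & ev f r = 0].
  by rewrite !mem_filter => /and3P[/eqP ? /eqP ? ?].
have G0G : {subset G0 <= G} by move=> r /G0P[].
pose GL := G ++ [seq - r | r <- G0].
have GLt g : g \in GL -> 0 <= ev tcol g.
  by rewrite mem_cat => /orP[/Gt//|/mapP[r /G0P[_ r0 _] ->]]; rewrite evN r0 oppr0.
have subGL z : polyhedron_of G z -> polyhedron_of GL z.
  by apply: sub_cone => g; rewrite mem_cat => ->.
apply: (reach_mono subGL); set C := polyhedron_of GL.
have hullC := @polyhedron_of_hull GL.
have z0C : integer_hull C z0.
  by apply/convE; apply: hull_mem; split=> //; apply: subGL.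
have GLray g : g \in GL -> ev tcol g = 0 -> ev f g <= 0.
  rewrite mem_cat => /orP[gG|/mapP[r /G0P[_ _ fr] ->] _]; last by rewrite evN fr oppr0.
  by move=> g0; exact: (ray_le0 z0G z0i fP gG (Gi _ gG) g0).
pose X := \matrix_(i < size G0) (tnth (in_tuple G0) i *m xproj).
have Xi : integral X.
  move=> i j; rewrite mxE; apply: integralM; last exact: integral_xproj.
  by apply: Gi; apply: G0G; apply: mem_tnth.
have [Pi [Pii XPi [Y PiE]]] := integral_projection Xi.
have G0Pi r : r \in G0 -> r *m (xproj *m (1%:M - Pi)) = 0.
  move=> /(nthP 0)[i iG0 <-]; rewrite mulmxA mulmxBr mulmx1.
  have := congr1 (row (Ordinal iG0)) XPi; rewrite row_mul !rowK (tnth_nth 0) /= => ->.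
  by rewrite subrr.
have [vinf vlex] : exists c, lex (k := k) C [:: f - c *: tcol].
  apply: (@lex_extend k p q C [::] f (- ev f (hom z0))) => //.
    have [B HB] := tilt_valid GLt GLray.
    by exists 0, B; rewrite addr0; split=> //; apply: reach_valid.
  by move=> t x -> /(reach_at hullC z0C); rewrite !evE tcol_hom; lra.
(* If [vinf >= e], the rest is a contradiction: some mixed-integer point of [P] would have
   [f >= vinf > 0]. *)
have [ve|ve] := ltP vinf e.
  have [_ vap _] := vlex; have [|t ->] := vap (e - vinf)%R; first by rewrite subr_gt0.
  congr (reach _ _ _); apply/colP => i; rewrite !mxE; lra.
pose f0 := f - vinf *: tcol.
pose w i : functional := col i (xproj *m (1%:M - Pi)).
have wE i g : ev (w i) g = (g *m (xproj *m (1%:M - Pi))) 0 i.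
  by rewrite /w colE -ev_mul ev_delta.
have wi i : w i = xproj *m col i (1%:M - Pi) by rewrite /w !colE mulmxA.
(* [w i] vanishes on the rays where [f] does, and on the others a multiple of [f] dominates
   [a * w i]. Thus [f0 >= 0] bounds [w i] on both sides. *)
have wbound i a : exists K B : R, 0 <= K /\ reach k C (a *: w i + K *: f0 - B *: tcol).
  have [g|g|N HN] := @tilt _ _ (rays GL) (a *: w i) f.
  - by rewrite mem_filter => /andP[/eqP g0 gG]; apply: GLray.
  - rewrite mem_filter mem_cat evZl wE => /andP[/eqP g0 /orP[gG|/mapP[r rG ->]]] fg.
      by rewrite G0Pi ?mxE ?mulr0 // !mem_filter g0 fg gG !eqxx.
    by rewrite mulNmx G0Pi // oppr0 mxE mulr0.
  have [|B HB] := @tilt_valid GL (a *: w i + N%:R *: f) GLt.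
    by move=> g gG g0; have := HN g; rewrite mem_filter g0 eqxx gG !evE; apply.
  exists N%:R, (B - N%:R * vinf)%R; split=> //; apply: reach_valid => z /HB.
  by rewrite /f0 !evE tcol_hom; lra.
have [fs [fsl fs0 fsw]] : exists fs, [/\ lex (k := k) C fs, f0 \in fs &
    forall i, i \in enum 'I_p -> exists2 c, c \is a Num.int & w i - c *: tcol \in fs].
  elim: (enum _) => [|i l [fs [fsl fs0 fsw]]].
    by exists [:: f0]; rewrite inE eqxx; split.
  have [K1 [B1 [K10 r1]]] := wbound i 1; have [K2 [B2 [K20 r2]]] := wbound i (-1)%R.
  have Kfs K : 0 <= K -> cone fs (K *: f0) by move=> K0; apply/coneZ/cone_mem.
  have [||c cl] := @lex_extend k p q C fs (w i) B2 fsl.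
  - by exists (K1 *: f0), B1; rewrite scale1r in r1; split=> //; apply: Kfs.
  - move=> t x tfs tr; rewrite leNgt; apply/negP => xB.
    have := reachD r2 tr; rewrite scaleN1r.
    have -> : - w i + K2 *: f0 - B2 *: tcol + (w i + t + x *: tcol) =
        t + K2 *: f0 + (x - B2) *: tcol by apply/colP => j; rewrite !mxE; lra.
    by apply: (lex_gt0 hullC z0C fsl); [apply: coneD => //; apply: Kfs|lra].
  exists (w i - c *: tcol :: fs); rewrite inE fs0 orbT; split=> // j.
  rewrite inE => /predU1P[->|/fsw[d di dfs]].
    exists c; last by rewrite inE eqxx.
    move: cl; rewrite wi; apply: lex_int => //.
    rewrite colE; apply: integralM; last exact: integral_delta.
    by apply: integralD; [apply: integral1|apply: integralN].
  by exists d; rewrite // inE dfs orbT.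
have /fin_all_exists[om omP] i : exists c, c \is a Num.int /\ w i - c *: tcol \in fs.
  by have [|c ci cfs] := fsw i; [rewrite mem_enum|exists c].
pose omv := rowv om.
(* [target] lies in the cone below exactly when a point of [P + L] has every [w i] equal to [om i]
   and [f0 >= 0]; [slack] relaxes [f0 = 0] to this inequality. *)
pose Phi := row_mx (xproj *m (1%:M - Pi) - tcol *m omv) (row_mx f0 tcol).
pose slack := row_mx 0 (row_mx (-1)%:M 0) : 'rV[R]_(p + (1 + 1)).
pose target := row_mx 0 (row_mx 0 1%:M) : 'rV[R]_(p + (1 + 1)).
have [E HE] := weyl (slack :: map (mulmxr Phi) GL).
have [infeasible|feasible] := boolP (has (fun h => 0 < ev h target) E).
  have [h hE ht] := hasP infeasible.
  have hG g : g \in slack :: map (mulmxr Phi) GL -> ev h g <= 0.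
    by move=> gG; apply: (proj1 (proj1 HE g)) => //; apply: cone_mem.
  pose s := usubmx h; pose s0 := usubmx (dsubmx h) 0 0; pose rho := dsubmx (dsubmx h) 0 0.
  have hE' : h = col_mx s (col_mx s0%:M rho%:M).
    rewrite -[LHS]vsubmxK -[dsubmx h]vsubmxK; congr (col_mx _ (col_mx _ _));
      by apply/colP => i; rewrite !ord1 [RHS]mxE eqxx mulr1n.
  have rho0 : 0 < rho.
    move: ht; rewrite hE' /ev /target !mul_row_col !mul0mx !add0r mul1mx mxE.
    by rewrite eqxx mulr1n.
  have s00 : 0 <= s0.
    have : ev h slack <= 0 by apply: hG; rewrite inE eqxx.
    rewrite hE' /ev /slack !mul_row_col !mul0mx add0r addr0 -scalar_mxM mxE eqxx.
    by rewrite mulr1n mulN1r oppr_le0.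
  pose hw i := w i - om i *: tcol.
  have hfs i : hw i \in fs by case: (omP i).
  have Phih : Phi *m h = \sum_i s i 0 *: hw i + s0 *: f0 + rho *: tcol.
    rewrite hE' /Phi !mul_row_col addrA; congr (_ + _ + _).
    - rewrite mulmx_sum_col; apply: eq_bigr => i _; congr (_ *: _).
      rewrite /hw /w raddfB /=; congr (_ - _).
      by apply/colP => j; rewrite !mxE big_ord1 !mxE mulrC.
    - by apply/colP => j; rewrite !mxE big_ord1 !mxE eqxx mulr1n mulrC.
    - by apply/colP => j; rewrite !mxE big_ord1 !mxE eqxx mulr1n mulrC.
  have r1 : reach k C (\sum_i s i 0 *: hw i + s0 *: f0 + rho *: tcol).
    apply: reach_valid => z; apply: ev_cone => g gG; rewrite -Phih -ev_mul.
    by apply: hG; rewrite inE (map_f (mulmxr Phi) gG) orbT.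
  (* The multipliers [s i] have any sign. Adding their negative parts makes them nonnegative,
     [lex_approx] bounds the addition by [rho / 2], and [lex_gt0] forbids what remains. *)
  pose neg x : R := Num.max 0 (- x).
  have negP x : 0 <= neg x /\ 0 <= x + neg x.
    by rewrite /neg; case: (leP 0 (- x)) => ?; lra.
  have tneg : cone fs (\sum_i neg (s i 0) *: hw i).
    by apply: cone_sum => i _; apply: coneZ; [case: (negP (s i 0))|apply: cone_mem].
  have [|t [tfs r2 _]] := @lex_approx k p q C fs _ _ (rho / 2)%R fsl tneg (cone0 fs).
    by rewrite divr_gt0.
  have := reachD r1 r2.
  have -> : \sum_i s i 0 *: hw i + s0 *: f0 + rho *: tcol +
      (\sum_i neg (s i 0) *: hw i + t - (rho / 2) *: tcol) =
      (\sum_i (s i 0 + neg (s i 0)) *: hw i + s0 *: f0 + t) + (rho / 2) *: tcol.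
    under [in RHS]eq_bigr do rewrite scalerDl.
    rewrite big_split /=; set a := \sum_i _; set b := \sum_i _.
    by apply/colP => j; rewrite !mxE; lra.
  move=> /(lex_gt0 hullC z0C fsl) []; last by rewrite divr_gt0.
  apply: coneD => //; apply: coneD; last by apply: coneZ => //; apply: cone_mem.
  by apply: cone_sum => i _; apply: coneZ; [case: (negP (s i 0))|apply: cone_mem].
exfalso.
have [s s0 /cone_map[z zGL zE]] : cone (slack :: map (mulmxr Phi) GL) target.
  by apply/(proj1 HE) => h hE; rewrite leNgt; apply: (hasPn feasible).
have [zx fz tz] : [/\ z *m (xproj *m (1%:M - Pi)) = ev tcol z *: omv, 0 <= ev f0 z & ev tcol z = 1].
  move: zE; rewrite /= /Phi /target /slack !mul_mx_row !scale_row_mx !opp_row_mx !add_row_mx.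
  move=> /eq_row_mx[zx /eq_row_mx[zf zt]].
  split; last by rewrite /ev -zt !mxE eqxx mulr0 subr0.
  2: by rewrite /ev -zf !mxE eqxx mulr1n mulrN1 opprK add0r.
  move/eqP: zx; rewrite scaler0 subr0 eq_sym mulmxBr subr_eq0 => /eqP ->.
  rewrite mulmxA; apply/rowP => j; rewrite !mxE big_ord1 !mxE; congr (_ * _).
  by rewrite /ev mxE.
rewrite tz scale1r mulmxA mulmxBr mulmx1 in zx.
(* [l] in [L] carries the component [Pi x] of [z], so [z - l] has the integral coordinates [om];
   [cone_lineality] moves it back into [P]. *)
pose c := z *m xproj *m Y.
pose l := \sum_i c 0 i *: tnth (in_tuple G0) i.
have lX : l *m xproj = z *m xproj *m Pi.
  rewrite PiE mulmxA -/c [RHS]mulmx_sum_row /l mulmx_suml; apply: eq_bigr => i _.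
  by rewrite rowK -scalemxAl.
have lG (g : functional) : (forall r, r \in G0 -> ev g r = 0) -> ev g l = 0.
  move=> g0; rewrite /l /ev mulmx_suml summxE big1 // => i _.
  by rewrite -scalemxAl mxE -/(ev _ _) g0 ?mulr0 // mem_tnth.
have zlGL : cone GL (z - l).
  apply: coneD => //; rewrite /l -sumrN; under eq_bigr do rewrite -scaleNr.
  by apply: mem_cone_lin => // i; apply: mem_tnth.
have [N HN] := cone_lineality G0G zlGL.
set r := \sum_(r <- G0) r in HN.
have rG (g : functional) : (forall r, r \in G0 -> ev g r = 0) -> ev g r = 0.
  by move=> g0; rewrite /r /ev mulmx_suml summxE big_seq big1.
have t0 s' : s' \in G0 -> ev tcol s' = 0 by case/G0P.
have f0' s' : s' \in G0 -> ev f s' = 0 by case/G0P.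
have [|y yE] := @homP p q (z - l + N%:R *: r).
  by rewrite !evE tz (lG _ t0) (rG _ t0); lra.
have : ev f (hom y) <= 0.
  apply: fP; first by rewrite /polyhedron_of -yE.
  apply/is_int_vecE; rewrite -xproj_hom -yE mulmxDl mulmxBl lX zx.
  apply: integralD.
    by move=> i j; rewrite mxE; case: (omP j).
  rewrite -scalemxAl; apply: integralZ; first exact: rpred_nat.
  apply: integralM; last exact: integral_xproj.
  rewrite /r big_seq; apply: (big_ind (fun x => integral x)).
  - exact: integral0.
  - by move=> *; apply: integralD.
  - by move=> i /G0G/Gi.
rewrite -yE !evE (lG _ f0') (rG _ f0'); move: fz; rewrite /f0 !evE tz; lra.
Qed.

End Approximation.

(** * Relative interiors and faces *)

Lemma ev_cone_eq0 n (f : 'cV[R]_n) (G : seq 'rV[R]_n) z :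
  (forall g, g \in G -> ev f g = 0) -> cone G z -> ev f z = 0.
Proof.
move=> fG zG; apply/eqP; rewrite eq_le; apply/andP; split.
  by apply: ev_cone zG => g /fG ->.
by rewrite -oppr_le0 -evNl; apply: ev_cone zG => g /fG; rewrite evNl => ->; rewrite oppr0.
Qed.

Section Relint.
Context {p : nat}.
Implicit Types (S : ('I_p -> R) -> Prop) (x : 'I_p -> R) (h : 'cV[R]_(p + 1)).

Definition homx x : 'rV[R]_(p + 1) := row_mx (rowv x) 1%:M.

Lemma homx_inj x x' : homx x = homx x' -> x = x'.
Proof.
move=> /eq_row_mx[/rowP xx _]; apply: functional_extensionality => i.
by have := xx i; rewrite !mxE.
Qed.

Lemma relint_extend S x x' : relint S x -> S x' ->
  exists2 t, 0 < t & S (fun i => x i + t * (x i - x' i)).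
Proof.
move=> [Sx [eps [/RltP eps0 HS]]] Sx'.
have [B HB] := row_bound (rowv (fun i => x i - x' i)%R).
have B1 : 0 < B%:R + 1 :> R by rewrite ltr_wpDl.
exists (eps / (2 * (B%:R + 1))); first by rewrite divr_gt0 ?mulr_gt0.
set t := _ / _; have t0 : 0 < t by rewrite divr_gt0 ?mulr_gt0.
apply: HS => [|i].
  exists [:: (1 + t, x); (- t, x')]%R; split; first by move=> w [<-|[<-|[]]].
  split; first by rewrite wtotalE !big_cons big_nil R1E /=; lra.
  by move=> i; rewrite wsumE !big_cons big_nil /=; lra.
apply/RltP; rewrite RabsE RminusE addrC addKr normrM (ger0_norm (ltW t0)).
have := HB i; rewrite mxE => Bi; apply: (@le_lt_trans _ _ (t * B%:R)%R).
  by rewrite ler_wpM2l // ltW.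
rewrite /t mulrAC ltr_pdivrMr ?mulr_gt0 //.
by rewrite ltr_pM2l //; have := ler0n R B; lra.
Qed.

Lemma aff_ev S v h : (forall x, S x -> ev h (homx x) = 0) -> aff S v -> ev h (homx v) = 0.
Proof.
move=> hS [l [lS [l1 vE]]].
have -> : homx v = \sum_(u <- l) u.1 *: homx u.2.
  have -> : homx v = row_mx (rowv (fun i => wsum l (fun u => u i))) (wtotal l)%:M.
    by rewrite l1; congr row_mx; apply/rowP => i; rewrite !mxE.
  elim: {l1 vE} l lS => [|u l IH] lS.
    rewrite big_nil; apply/rowP => j; rewrite !mxE; case: split => {}j; rewrite !mxE //.
    by rewrite !ord1 eqxx.
  rewrite big_cons -IH; last by move=> w wl; apply: lS; right.
  rewrite /homx scale_row_mx add_row_mx scalemx1 -raddfD /=.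
  by congr row_mx; apply/rowP => i; rewrite !mxE.
elim: l {l1 vE} lS => [|u l IH] lS; first by rewrite big_nil ev0.
rewrite big_cons evD evZ IH ?addr0; last by move=> w wl; apply: lS; right.
by rewrite hS ?mulr0 //; apply: lS; left.
Qed.

Lemma open_halfspaces (H : seq 'cV[R]_(p + 1)) x :
  (forall h, h \in H -> ev h (homx x) < 0) ->
  exists2 eps : R, 0 < eps & forall h x', h \in H ->
    (forall i, `|x' i - x i| < eps) -> ev h (homx x') <= 0.
Proof.
elim: H => [|h H IH] Hx; first by exists 1; rewrite ?ltr01.
have [|e e0 He] := IH; first by move=> h' h'H; apply: Hx; rewrite inE h'H orbT.
have hx : ev h (homx x) < 0 by apply: Hx; rewrite inE eqxx.
pose s := \sum_i `|h (lshift 1 i) 0|; have s0 : 0 <= s by apply: sumr_ge0.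
pose e1 := - ev h (homx x) / (1 + s).
have e10 : 0 < e1 by rewrite divr_gt0 ?oppr_gt0 // ltr_pwDl.
exists (Num.min e e1); first by rewrite lt_min e0 e10.
move=> h' x'; rewrite inE => /predU1P[-> xx|h'H xx]; last first.
  by apply: He => // i; have := xx i; rewrite lt_min => /andP[].
have -> : ev h (homx x') = ev h (homx x) + \sum_i (x' i - x i) * h (lshift 1 i) 0.
  rewrite /ev -[h in LHS]vsubmxK -[h in X in X + _]vsubmxK !mul_row_col mxE [in RHS]mxE.
  rewrite addrAC; congr (_ + _); rewrite !mxE -big_split /=.
  by apply: eq_bigr => i _; rewrite !mxE; ring.
have : \sum_i (x' i - x i) * h (lshift 1 i) 0 <= e1 * s.
  rewrite mulr_sumr; apply: ler_sum => i _; apply: le_trans (ler_norm _) _.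
  rewrite normrM ler_wpM2r //; have := xx i; rewrite lt_min => /andP[_ /ltW]; exact.
have : e1 * (1 + s) = - ev h (homx x) by rewrite divfK // gt_eqF // ltr_pwDl.
lra.
Qed.

(** Equations of [S] persist on its affine hull, and inequalities strict at [x] persist near [x]. *)
Lemma relint_halfspaces S (H : seq 'cV[R]_(p + 1)) x :
  (forall x', S x' <-> forall h, h \in H -> ev h (homx x') <= 0) ->
  (forall h, h \in H -> (forall x', S x' -> ev h (homx x') = 0) /\ ev h (homx x) = 0 \/
    ev h (homx x) < 0) ->
  relint S x.
Proof.
move=> SH Hx; have [h|eps eps0 Heps] := @open_halfspaces [seq h <- H | ev h (homx x) < 0] x.
  by rewrite mem_filter => /andP[].
split; first by apply/SH => h /Hx[[_ ->]|/ltW].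
exists eps; split; first exact/RltP.
move=> x' x'S xx; apply/SH => h hH; have [[hS _]|hx] := Hx h hH.
  by rewrite (aff_ev hS x'S).
apply: Heps => [|i]; first by rewrite mem_filter hx.
by have /RltP := xx i; rewrite RabsE.
Qed.

End Relint.

Section Faces.
Context {p q : nat}.
Implicit Types (G : seq 'rV[R]_(p + (q + 1))) (f u : 'cV[R]_(p + (q + 1))) (M F : pt p q -> Prop).

(** A generator of height 0 is not a point, so [f] is tested at [z0 + N g] rescaled to height 1, for
    [N] large. *)
Lemma valid_gen G f z0 g : (forall g, g \in G -> 0 <= ev tcol g) -> cone G (hom z0) ->
  (forall z, cone G (hom z) -> ev f (hom z) <= 0) -> g \in G -> ev f g <= 0.
Proof.
move=> Gt z0G fP gG; rewrite leNgt; apply/negP => fg.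
have [N HN] := nat_ub ((1 - ev f (hom z0)) / ev f g).
have a0 : 0 < 1 + N%:R * ev tcol g by rewrite ltr_pwDl // mulr_ge0 // Gt.
have [|z zE] := @homP p q ((1 + N%:R * ev tcol g)^-1 *: (hom z0 + N%:R *: g)).
  by rewrite !evE tcol_hom mulVf // gt_eqF.
have := fP z; rewrite -zE evZ pmulr_rle0 ?invr_gt0 // !evE => H.
have {H} : ev f (hom z0) + N%:R * ev f g <= 0.
  apply: H; apply: coneZ; first by rewrite invr_ge0 ltW.
  by apply: coneD => //; apply/coneZ/cone_mem.
rewrite ler_pdivrMr // in HN; lra.
Qed.

(* If [phi <= 0] cuts out [F] from the face [u = 0] of [M], then so does
   [phi + N u <= 0] from [M] itself, for [N] large. *)
Lemma face_trans G u z1 M M' F :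
  (forall g, g \in G -> 0 <= ev tcol g) -> (forall z, M z <-> cone G (hom z)) ->
  (forall g, g \in G -> ev u g <= 0) ->
  (forall z, M' z <-> M z /\ ev u (hom z) = 0) -> M' z1 ->
  nonempty_face M' F -> nonempty_face M F.
Proof.
move=> Gt MG uG M'M M'z1 [Fn [a [b [beta [valid FP]]]]]; split=> //.
pose phi := affine a b beta.
pose G' := [seq g <- G | ev u g == 0].
have M'G z : M' z <-> cone G' (hom z).
  rewrite M'M MG; split=> [[zG uz]|zG']; first exact: cone_face.
  split; first by apply: sub_cone zG' => g; rewrite mem_filter => /andP[].
  by apply: ev_cone_eq0 zG' => g; rewrite mem_filter => /andP[/eqP].
have phiG' g : g \in G' -> ev phi g <= 0.
  apply: (@valid_gen G' phi z1); [|exact/M'G|].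
    by move=> h; rewrite mem_filter => /andP[_ /Gt].
  by move=> z /M'G/valid/RleP; rewrite ev_affine subr_le0.
have [|g gG ug|N HN] := @tilt _ _ G phi u; first exact: uG.
  by apply: phiG'; rewrite mem_filter ug eqxx.
(* With one more [u] than [N], equality forces [u = 0] as well. *)
have [a' [b' [beta' psiE]]] := affineK (phi + (N%:R + 1) *: u).
have psi z : lin a' b' z - beta' = ev phi (hom z) + (N%:R + 1) * ev u (hom z).
  by rewrite -ev_affine -psiE evDl evZl.
have le1 z : M z -> ev phi (hom z) + N%:R * ev u (hom z) <= 0.
  by move/MG; rewrite -evZl -evDl; apply: ev_cone => g /HN; rewrite evDl evZl.
have le2 z : M z -> ev u (hom z) <= 0 by move/MG; apply: ev_cone.
exists a', b', beta'; split=> [z Mz|z].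
  by apply/RleP; rewrite -subr_le0 psi; have := le1 z Mz; have := le2 z Mz; lra.
rewrite FP M'M; split.
  move=> [[Mz uz] /eqP]; rewrite -subr_eq0 -ev_affine -/phi => /eqP pz.
  by split=> //; apply/eqP; rewrite -subr_eq0 psi pz uz mulr0 addr0.
move=> [Mz /eqP]; rewrite -subr_eq0 psi => /eqP pz.
have := le1 z Mz; have := le2 z Mz => l2 l1.
have uz : ev u (hom z) = 0 by lra.
split=> //; apply/eqP; rewrite -subr_eq0 -ev_affine -/phi; apply/eqP.
by move: pz; rewrite uz mulr0 addr0.
Qed.

End Faces.

(** * Exact derivation *)

(** The covering hypothesis as a predicate of [M], which faces inherit through [face_trans]. *)
Definition lattice_free_covered (k p q : nat) (M : pt p q -> Prop) :=
  forall F : pt p q -> Prop, nonempty_face M F ->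
    (forall x, relint (proj_X F) x -> ~ is_int_vec x) ->
    exists (d : 'I_k -> 'I_p -> Z) (delta : 'I_k -> Z),
      k_disjunction d delta /\
      forall x, relint (proj_X F) x -> forall i, Rlt (IZR (delta i)) (dot (dvec d i) x).

Section Main.
Context {k p q : nat}.
Variables (P : pt p q -> Prop) (G GI : seq 'rV[R]_(p + (q + 1))) (z0 : pt p q).
Hypotheses (k2 : (2 <= k)%N)
  (Gi : forall g, g \in G -> integral g) (Gt : forall g, g \in G -> 0 <= ev tcol g)
  (GP : forall z, P z <-> cone G (hom z))
  (GIi : forall g, g \in GI -> integral g) (GIt : forall g, g \in GI -> 0 <= ev tcol g)
  (GIP : forall z, integer_hull P z <-> cone GI (hom z))
  (z0P : P z0) (z0i : is_int_vec z0.1).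
Local Notation reach := (reach k P).
Implicit Types (f u : 'cV[R]_(p + (q + 1))) (z : pt p q).

Definition opt_face f z := integer_hull P z /\ ev f (hom z) = 0.
Definition tight f := [seq g <- GI | ev f g == 0].

Lemma integer_hull_mem z : P z -> is_int_vec z.1 -> integer_hull P z.
Proof. by move=> Pz zi; apply/convE/hull_mem. Qed.

Lemma integer_hull_sub z : integer_hull P z -> P z.
Proof.
move=> /convE zP; apply/GP; move: zP; apply: hull_min.
- exact: cone0.
- by move=> *; apply: coneD.
- by move=> t y t0 [/GP yG _]; apply: coneZ.
Qed.

Lemma reach_hull_approx f e :
  (forall g, g \in GI -> ev f g <= 0) -> 0 < e -> reach (f - e *: tcol).
Proof.
move=> fGI e0; apply: (@reach_mono _ _ _ P (polyhedron_of G)) => [z /GP //|].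
apply: (reach_approx k2 Gi Gt (proj1 (GP z0) z0P)) => // z /GP Pz zi.
have /GIP := integer_hull_mem Pz zi; exact: ev_cone.
Qed.

Lemma tight_tcol f g : g \in tight f -> 0 <= ev tcol g.
Proof. by rewrite mem_filter => /andP[_ /GIt]. Qed.

Lemma opt_face_cone f z : (forall g, g \in GI -> ev f g <= 0) ->
  opt_face f z <-> cone (tight f) (hom z).
Proof.
move=> fGI; rewrite /opt_face GIP; split=> [[zG fz]|zG]; first exact: cone_face.
split; first by apply: sub_cone zG => g; rewrite mem_filter => /andP[].
by apply: ev_cone_eq0 zG => g; rewrite mem_filter => /andP[/eqP].
Qed.

Definition xtproj : 'M[R]_(p + (q + 1), p + 1) := row_mx xproj tcol.

Lemma xtproj_hom z : hom z *m xtproj = homx z.1.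
Proof.
rewrite /xtproj mul_mx_row xproj_hom; congr row_mx.
by apply/colP => i; rewrite !ord1 -/(ev _ _) -[LHS]/(ev tcol (hom z)) tcol_hom mxE eqxx.
Qed.

Lemma proj_opt_face f x : (forall g, g \in GI -> ev f g <= 0) ->
  proj_X (opt_face f) x <-> cone (map (mulmxr xtproj) (tight f)) (homx x).
Proof.
move=> fGI; rewrite cone_map; split=> [[y /(opt_face_cone _ fGI) zG]|[w wG xw]].
  by exists (hom (x, y)); rewrite //= xtproj_hom.
have [|z zE] := @homP p q w.
  move: xw; rewrite /= /homx /xtproj mul_mx_row => /eq_row_mx[_ /matrixP/(_ 0 0)].
  by rewrite [LHS]mxE eqxx /ev => <-.
rewrite zE /= xtproj_hom in xw; move/homx_inj: xw => ->.
by exists z.2; rewrite -surjective_pairing; apply/(opt_face_cone _ fGI); rewrite -zE.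
Qed.

Lemma integral_xtproj : integral xtproj.
Proof. by apply: integral_row_mx; [apply: integral_xproj|apply: integral_tcol]. Qed.

(* [W - m f] is the LP dual certificate of [f <= 0] on the fiber of [P] above [xb]. *)
Lemma reach_integer_point f xb : integral f -> (forall g, g \in GI -> ev f g <= 0) ->
  relint (proj_X (opt_face f)) xb -> is_int_vec xb -> reach f.
Proof.
move=> fi fGI xbM xbi.
have [[yb Mb] _] := xbM; have [hullb fb] := Mb.
have xbi' : integral (rowv xb) by apply/is_int_vecE.
have MP z : opt_face f z -> P z by case=> /integer_hull_sub.
pose Psi := row_mx (xproj - tcol *m rowv xb) f.
pose target := row_mx 0 1%:M : 'rV[R]_(p + 1).
(* A member would be a point or ray over [xb] with [f > 0]. Adding the optimal point over [xb]
   ensures positive height, and rescaling yields a mixed-integer point with [f > 0]. *)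
have ntarget : ~ cone (map (mulmxr Psi) G) target.
  move=> /cone_map[w wG /=]; rewrite /Psi mul_mx_row => /eq_row_mx[wx wf].
  have {}wf : ev f w = 1 by rewrite /ev -wf mxE.
  have w0 : 0 <= ev tcol w by apply: tcol_cone wG.
  have w1 : 0 < ev tcol w + 1 by lra.
  pose s := (ev tcol w + 1)^-1; have s0 : 0 < s by rewrite invr_gt0.
  have [|z zE] := @homP p q (s *: (w + hom (xb, yb))).
    by rewrite evZ evD tcol_hom mulVf // gt_eqF.
  have Pz : P z.
    apply/GP; rewrite -zE; apply: coneZ; first exact: ltW.
    by apply: coneD => //; apply/GP/MP.
  have zi : is_int_vec z.1.
    apply/is_int_vecE; rewrite -xproj_hom -zE -scalemxAl mulmxDl xproj_hom /=.
    move/eqP: wx; rewrite mulmxBr eq_sym subr_eq0 => /eqP ->.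
    have -> : w *m (tcol *m rowv xb) = ev tcol w *: rowv xb.
      rewrite mulmxA; apply/rowP => i; rewrite !mxE big_ord1 !mxE.
      by congr (_ * _); rewrite /ev mxE.
    by rewrite -[X in _ + X]scale1r -scalerDl scalerA mulVf ?scale1r // gt_eqF.
  have /GIP/(ev_cone fGI) := integer_hull_mem Pz zi.
  by rewrite -zE evZ evD wf fb addr0 mulr1; lra.
have [h [hG ht hi]] := farkas ntarget.
have {}hi : integral h.
  apply: hi => _ /mapP[g gG ->]; apply: integralM; first exact: Gi.
  apply: integral_row_mx => //; apply: integralD; first exact: integral_xproj.
  by apply/integralN/integralM => //; apply: integral_tcol.
have [s sE] : exists s, s = - usubmx h by exists (- usubmx h).
pose m := dsubmx h 0 0; pose c := ev s (rowv xb).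
have si : integral s by rewrite sE; apply: integralN => i j; rewrite mxE; apply: hi.
have hE : h = col_mx (- s) m%:M.
  rewrite sE opprK -[LHS]vsubmxK; congr col_mx.
  by apply/colP => i; rewrite !ord1 [RHS]mxE eqxx mulr1n.
have m0 : 0 < m.
  by move: ht; rewrite hE /ev /target mul_row_col mul0mx add0r mul1mx mxE eqxx mulr1n.
have ci : c \is a Num.int by apply: integral_ev.
pose W : 'cV[R]_(p + (q + 1)) := xproj *m s - c *: tcol.
have Wi : integral W.
  apply: integralD; first by apply: integralM => //; apply: integral_xproj.
  by apply/integralN/integralZ => //; apply: integral_tcol.
have WE z : ev W (hom z) = ev s (rowv z.1) - c.
  by rewrite !evE tcol_hom mulr1 -ev_mul xproj_hom.
have PsihE : Psi *m h = m *: f - W.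
  rewrite hE /Psi mul_row_col mulmxN mulmxBl opprB -mulmxA addrC; congr (_ + _).
    by apply/colP => i; rewrite !mxE big_ord1 !mxE eqxx mulr1n mulrC.
  rewrite /W opprB; congr (_ - _).
  by apply/colP => i; rewrite !mxE big_ord1 mulrC /c /ev !mxE.
have fW z : P z -> m * ev f (hom z) <= ev W (hom z).
  move/GP; have := @ev_cone _ _ (m *: f - W) G (hom z).
  rewrite evDl evNl evZl subr_le0; apply=> g gG; rewrite -PsihE -ev_mul.
  by apply: hG; apply: (map_f (mulmxr Psi)).
(* Slightly beyond [xb], seen from [z], lies the projection of a point of the face, where [W >= 0].
   As [W] is affine in [x] and 0 at [xb], it is nonpositive at [z]. *)
have W0 z : opt_face f z -> ev W (hom z) <= 0.
  move=> Mz; have [t t0 [y My]] : exists2 t, 0 < t &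
      proj_X (opt_face f) (fun i => xb i + t * (xb i - z.1 i)).
    by apply: relint_extend xbM _; exists z.2; rewrite -surjective_pairing.
  have := fW _ (MP _ My); have [_ ->] := My; rewrite mulr0 !WE /=.
  have -> : rowv (fun i => xb i + t * (xb i - z.1 i)) =
    rowv xb + t *: (rowv xb - rowv z.1) by apply/rowP => i; rewrite !mxE.
  rewrite !evE -/c => H; have {H} : 0 <= t * (c - ev s (rowv z.1)) by lra.
  by rewrite pmulr_rge0 //; lra.
have [|g gG fg|N HN] := @tilt _ _ GI W f; first exact: fGI.
  apply: (@valid_gen p q (tight f) W (xb, yb) g); first exact: tight_tcol.
  - by apply/opt_face_cone.
  - by move=> z /(opt_face_cone _ fGI); apply: W0.
  - by rewrite mem_filter fg eqxx.
(* Where [f > 0], this gives [W <= 1/2] while [fW] gives [W > 0]; any constant strictly between 0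
   and 1 would do. *)
have [n Hn] : reach (W + N%:R *: f - 2^-1 *: tcol).
  by apply: reach_hull_approx => [g /HN|]; rewrite ?evDl ?evZl // invr_gt0.
apply: (@reach_split _ _ _ _ _ n s c) => // z zn fz.
have := Hn z zn; have := fW z (rank_le (leq0n n) zn).
rewrite (evDl (W + _)) (evDl W) WE evNl !evZl tcol_hom xproj_hom.
have : 0 < m * ev f (hom z) by apply: mulr_gt0.
have : 0 <= N%:R * ev f (hom z) by rewrite mulr_ge0 // ltW.
lra.
Qed.

(** [f] is nonpositive at all mixed-integer points of a combination, so those of positive weight
    attain 0. Such a point serves as an integral origin of the affine hull. *)
Lemma int_opt_point f z : (forall g, g \in GI -> ev f g <= 0) -> opt_face f z ->
  exists2 y, opt_face f y & is_int_vec y.1.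
Proof.
move=> fGI [/convE zh fz].
suff [_ _ H] : [/\ 0 <= ev tcol (hom z), ev f (hom z) <= 0 &
    0 < ev tcol (hom z) -> ev f (hom z) = 0 -> exists2 y, opt_face f y & is_int_vec y.1].
  by apply: H => //; rewrite tcol_hom.
move: zh; apply: (hull_min (K := fun w => [/\ 0 <= ev tcol w, ev f w <= 0 &
    0 < ev tcol w -> ev f w = 0 -> exists2 y, opt_face f y & is_int_vec y.1])).
- by rewrite !ev0; split=> //; rewrite ltxx.
- move=> x y [x0 fx Hx] [y0 fy Hy]; rewrite !evD; split=> [||xy0 fxy]; [lra|lra|].
  have [xp|xp] := ltP 0 (ev tcol x); first by apply: Hx => //; lra.
  by apply: Hy; lra.
move=> t y t0 [Py yi]; have hy := integer_hull_mem Py yi.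
have fy : ev f (hom y) <= 0 by move/GIP: hy; apply: ev_cone.
rewrite !evZ tcol_hom mulr1; split=> // [|tp /eqP]; first exact: mulr_ge0_le0.
by rewrite mulf_eq0 gt_eqF //= => /eqP fy0; exists y.
Qed.

Lemma size_filter_lt (T : eqType) (a : pred T) (s : seq T) x :
  x \in s -> ~~ a x -> (size (filter a s) < size s)%N.
Proof.
move=> xs ax; rewrite size_filter ltn_neqAle count_size andbT -all_count.
by apply/allPn; exists x.
Qed.

(* The given disjunction excludes the relative interior of [proj_X (opt_face f)],
   but not its neighbourhood outside the affine hull; composed with the integral
   projection [pi] onto the affine hull, it excludes the whole preimage under [pi].
   When a halfspace of [proj_X (opt_face f)] is tight at no point, there is no face
   to apply induction to, but then [reach_hull_approx] suffices. *)
Lemma reach_opt_face f : integral f -> (forall g, g \in GI -> ev f g <= 0) ->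
  (exists z, opt_face f z) -> lattice_free_covered k (opt_face f) -> reach f.
Proof.
have [m] := ubnP (size (tight f)); elim: m f => // m IH f; rewrite ltnS => fm fi fGI [z1 Mz1] Hf.
have [[xb xbM xbi]|nint] := Classical_Prop.classic
    (exists2 x, relint (proj_X (opt_face f)) x & is_int_vec x).
  exact: reach_integer_point xbM xbi.
have [|x xM xi|d [delta [disj dM]]] := Hf (opt_face f).
- split; first by exists z1.
  exists (fun=> 0%R), (fun=> 0%R), 0%R.
  have lin0 z : lin (fun=> 0%R) (fun=> 0%R) z = 0 :> R.
    have c0 n : colv (fun _ : 'I_n => 0%R) = 0 by apply/colP => i; rewrite !mxE.
    by rewrite /lin !dotE !c0 !ev0l; exact: addr0.
  by split=> [z _|z]; rewrite lin0; [apply/RleP|split=> [|[]]].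
- by apply: nint; exists x.
have [zI MzI zIi] := int_opt_point fGI Mz1.
pose x0 := rowv zI.1; have x0i : integral x0 by apply/is_int_vecE.
pose T := tight f.
(* The rows span the directions of the affine hull through [x0]; [Theta] encodes
   [x0 + (x - x0) Pi]. *)
pose L : 'M[R]_(size T, p) := \matrix_(i < size T) (tnth (in_tuple T) i *m (xproj - tcol *m x0)).
have Ti g : g \in T -> integral g by rewrite mem_filter => /andP[_ /GIi].
have shift_i : integral (xproj - tcol *m x0 : 'M[R]_(p + (q + 1), p)).
  apply: integralD; first exact: integral_xproj.
  by apply/integralN/integralM => //; apply: integral_tcol.
have Li : integral L.
  move=> i j; rewrite mxE; apply: integralM => //.
  by apply: Ti; apply: mem_tnth.
have [Pi [Pii LPi [Y PiE]]] := integral_projection Li.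
pose Theta : 'M[R]_(p + (q + 1), p) := tcol *m x0 + (xproj - tcol *m x0) *m Pi.
have Thetai : integral Theta.
  apply: integralD; last exact: integralM.
  by apply: integralM => //; apply: integral_tcol.
have TTheta g : g \in T -> g *m Theta = g *m xproj.
  move=> /(nthP 0)[i iT <-]; rewrite /Theta mulmxDr mulmxA.
  have := congr1 (row (Ordinal iT)) LPi; rewrite row_mul !rowK (tnth_nth 0) /= => H.
  by rewrite mulmxA H mulmxBr mulmxA addrC subrK.
pose pi z : 'I_p -> R := fun i => (hom z *m Theta) 0 i.
have piE z : rowv (pi z) = hom z *m Theta by apply: rowvK.
have [Hs [HsP Hsi]] := weyl (map (mulmxr xtproj) T).
have {}Hsi h : h \in Hs -> integral h.
  by apply: Hsi => _ /mapP[g /Ti gi ->]; apply: integralM => //; apply: integral_xtproj.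
have projP x : proj_X (opt_face f) x <-> forall h, h \in Hs -> ev h (homx x) <= 0.
  by rewrite proj_opt_face // HsP.
pose lift h : 'cV[R]_(p + (q + 1)) := row_mx Theta tcol *m h.
have lift_hom h z : ev (lift h) (hom z) = ev h (homx (pi z)).
  rewrite -ev_mul mul_mx_row /homx piE; congr (ev _ (row_mx _ _)).
  by apply/colP => i; rewrite !ord1 -[LHS]/(ev tcol (hom z)) tcol_hom mxE eqxx.
have liftT h g : g \in T -> ev (lift h) g = ev h (g *m xtproj).
  by move=> gT; rewrite -ev_mul !mul_mx_row TTheta.
have lift_le0 h g : h \in Hs -> g \in T -> ev (lift h) g <= 0.
  move=> hHs gT; rewrite liftT //; apply: (proj1 (HsP _)) => //.
  exact/cone_mem/(map_f (mulmxr xtproj)).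
have lifti h : h \in Hs -> integral (lift h).
  by move=> /Hsi hi; apply: integralM => //; apply: integral_row_mx => //; apply: integral_tcol.
have tight_in g : g \in GI -> ev f g = 0 -> g \in T by rewrite mem_filter => -> ->; rewrite eqxx.
(* If [lift h] is 0 on all of [T], then [h] is an equation of the affine hull and defines no smaller
   face. Otherwise [K + rho > 0] turns [f > 0] into [h < 0] at [pi x]. *)
have facet h : h \in Hs -> (exists2 g, g \in T & ev (lift h) g != 0) ->
    exists K rho : R, [/\ 0 <= K, 0 <= rho, 0 < K + rho &
      reach (lift h + K *: f + rho *: tcol)].
  move=> hHs [g1 g1T hg1].
  have [[z Mz hz]|nz] := Classical_Prop.classic (exists2 z, opt_face f z & ev (lift h) (hom z) = 0).
    have [|g gGI fg|N HN] := @tilt _ _ GI (lift h) f; first exact: fGI.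
      by apply: lift_le0 => //; apply: tight_in.
    (* The extra [f] makes [f' = 0] force [f = 0]; the tight generators are then those of [f] with
       [lift h = 0], and [g1] is lost. *)
    pose f' := lift h + (N%:R + 1) *: f.
    have f'E g : ev f' g = (ev (lift h) g + N%:R * ev f g) + ev f g.
      by rewrite /f' evDl evZl; lra.
    have f'GI g : g \in GI -> ev f' g <= 0.
      by move=> gGI; rewrite f'E; have := HN g gGI; have := fGI g gGI; lra.
    have tf' : tight f' = [seq g <- T | ev (lift h) g == 0].
      rewrite /tight -filter_predI; apply: eq_in_filter => g gGI /=; rewrite f'E.
      apply/eqP/andP => [H|[/eqP -> /eqP ->]]; last by lra.
      have := HN g gGI; have := fGI g gGI => l1 l2.
      have fg : ev f g = 0 by lra.
      by move: H; rewrite fg mulr0 !addr0 => ->; rewrite eqxx.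
    have faceE y : opt_face f' y <-> opt_face f y /\ ev (lift h) (hom y) = 0.
      rewrite /opt_face /f' evDl evZl; split=> [[hy H]|[[hy fy] ->]]; last first.
        by split=> //; rewrite fy; lra.
      have fy : ev f (hom y) <= 0 by move/GIP: hy; apply: ev_cone.
      have : ev (lift h) (hom y) + N%:R * ev f (hom y) <= 0.
        rewrite -evZl -evDl; move/GIP: hy; apply: ev_cone => g /HN; by rewrite evDl evZl.
      move=> l2; have fy0 : ev f (hom y) = 0 by lra.
      by move: H; rewrite fy0 mulr0 addr0.
    exists (N%:R + 1)%R, 0%R; rewrite scale0r !addr0; split=> //;
      try by rewrite ?ltr_wpDl ?addr_ge0.
    apply: (IH f') => //.
    - apply: leq_trans fm; rewrite tf'; exact: size_filter_lt g1T hg1.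
    - apply: integralD; first exact: lifti.
      by apply: integralZ => //; rewrite rpredD ?rpred1 ?rpred_nat.
    - by exists z; apply/faceE.
    - move=> F FM; apply: Hf.
      apply: (face_trans (G := T) (u := lift h) (z1 := z) _ _ _ faceE) => //.
      + exact: tight_tcol.
      + by move=> y; apply: opt_face_cone.
      + by move=> g; apply: lift_le0.
      + exact/faceE.
  (* As [h] never vanishes on the face, it is at most [- rho] there, with [rho = 1/N]. Half of this
     gap pays for the approximation. *)
  have [g gT|g gT hg|N HN] := @tilt _ _ T tcol (lift h); first exact: lift_le0.
    rewrite leNgt; apply/negP => tg; apply: nz.
    have [|z zE] := @homP p q ((ev tcol g)^-1 *: g); first by rewrite evZ mulVf // gt_eqF.
    exists z; last by rewrite -zE evZ hg mulr0.
    apply/opt_face_cone => //; rewrite -zE; apply: coneZ; last exact: cone_mem.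
    by rewrite invr_ge0 ltW.
  have N0 : 0 < N%:R :> R.
    rewrite ltr0n lt0n; apply/negP => /eqP N0.
    have : ev tcol (hom z1) <= 0.
      move/(opt_face_cone _ fGI): Mz1; apply: ev_cone => g /HN.
      by rewrite N0 mul0r addr0.
    by rewrite tcol_hom; lra.
  pose rho : R := N%:R^-1; have rho0 : 0 < rho by rewrite invr_gt0.
  have [|g gGI fg|K HK] := @tilt _ _ GI (lift h + rho *: tcol) f; first exact: fGI.
    have := HN g (tight_in g gGI fg); rewrite evDl evZl -(pmulr_rle0 _ rho0) mulrDr.
    by rewrite mulrA mulVf ?gt_eqF // mul1r addrC.
  have rho20 : 0 < rho / 2 by rewrite divr_gt0.
  exists K%:R, (rho / 2)%R; split=> //; [exact: ltW|exact: ltr_wpDl|].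
  have : reach (lift h + rho *: tcol + K%:R *: f - (rho / 2) *: tcol).
    by apply: reach_hull_approx => [g /HK H|//]; rewrite evDl (evZl K%:R).
  congr (reach _); apply/colP => i; rewrite !mxE; lra.
have [n Hn] : exists n, forall z, kdisj_rank k P n z -> 0 < ev f (hom z) ->
    forall h, h \in Hs -> (exists2 g, g \in T & ev (lift h) g != 0) -> ev h (homx (pi z)) < 0.
  elim: {HsP projP lift_le0} Hs Hsi lifti facet => [|h Hs IHs] Hsi lifti facet; first by exists 0%N.
  have [n1 Hn1] : exists n, forall z, kdisj_rank k P n z -> 0 < ev f (hom z) ->
      (exists2 g, g \in T & ev (lift h) g != 0) -> ev h (homx (pi z)) < 0.
    have [nontriv|triv] := Classical_Prop.classic (exists2 g, g \in T & ev (lift h) g != 0);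
      last by exists 0%N.
    have [|K [rho [K0 rho0 Krho [n Hn]]]] := facet h _ nontriv; first by rewrite inE eqxx.
    exists n => z /Hn; rewrite !evDl !evZl lift_hom tcol_hom => H fz _.
    have [Kp|Kp] := ltP 0 K; first by have := mulr_gt0 Kp fz; lra.
    by have := mulr_ge0 K0 (ltW fz); lra.
  have [h' h'Hs|h' h'Hs|h' h'Hs|n2 Hn2] := IHs;
    try by [apply: Hsi; rewrite inE h'Hs orbT|apply: lifti; rewrite inE h'Hs orbT
           |apply: facet; rewrite inE h'Hs orbT].
  exists (maxn n1 n2) => z zn fz h'; rewrite inE => /predU1P[->|].
    exact: Hn1 (rank_le (leq_maxl n1 n2) zn) fz.
  exact: Hn2 (rank_le (leq_maxr n1 n2) zn) fz h'.
pose t0 := x0 - x0 *m Pi.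
have t0i : integral t0 by apply: integralD => //; apply/integralN/integralM.
have piP z : rowv (pi z) = t0 + rowv z.1 *m Pi.
  rewrite piE /Theta mulmxDr mulmxA [hom z *m (_ *m Pi)]mulmxA mulmxBr xproj_hom.
  have -> : hom z *m tcol = 1%:M.
    by apply/colP => i; rewrite !ord1 -[LHS]/(ev tcol (hom z)) tcol_hom mxE eqxx.
  rewrite mulmxA; have -> : hom z *m tcol = 1%:M.
    by apply/colP => i; rewrite !ord1 -[LHS]/(ev tcol (hom z)) tcol_hom mxE eqxx.
  by rewrite !mul1mx mulmxBl addrA addrAC.
have dveci i : integral (colv (dvec d i)) by move=> a b; rewrite mxE; apply: IZR_int.
(* Substituting [t0 + x Pi] for [x] in the disjunction keeps it integral; the constant from [t0]
   moves to the right-hand side. *)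
apply: (@reach_cut _ _ _ _ _ n (fun i => Pi *m colv (dvec d i))
  (fun i => IZR (delta i) - ev (colv (dvec d i)) t0)).
- by move=> i; apply: integralM.
- by move=> i; rewrite rpredB ?IZR_int // integral_ev.
- move=> x xi; have [|i Hi] := disj (fun i => (t0 + x *m Pi) 0 i).
    by apply/is_int_vecE; rewrite rowvK; apply: integralD => //; apply: integralM.
  exists i; move/RleP: Hi; rewrite dotE rowvK evD ev_mul; lra.
move=> z zn fz i; rewrite xproj_hom ltrBlDl -ev_mul -evD -piP -dotE; apply/RltP.
apply: dM; apply: (relint_halfspaces projP) => h hHs.
have [nontriv|triv] := Classical_Prop.classic (exists2 g, g \in T & ev (lift h) g != 0).
  by right; apply: Hn zn fz h hHs nontriv.
have hT g : g \in T -> ev h (g *m xtproj) = 0.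
  move=> gT; rewrite -liftT //; apply/eqP; apply/negP => hg; apply: triv.
  by exists g => //; apply/negP.
have hM x : proj_X (opt_face f) x -> ev h (homx x) = 0.
  move/(proj_opt_face _ fGI); apply: ev_cone_eq0 => _ /mapP[g gT ->]; exact: hT.
left; split=> //.
(* [h] vanishes on the affine hull, which contains [pi z] even when [z] is far from the face. *)
pose a := usubmx h; pose b := dsubmx h 0 0.
have hE x t : ev h (row_mx x t) = ev a x + t 0 0 * b.
  by rewrite /ev -[h]vsubmxK mul_row_col mxE [(t *m _) 0 0]mxE big_ord1.
have x00 : ev a x0 + b = 0.
  have <- : ev h (homx zI.1) = 0 by apply: hM; exists zI.2; rewrite -surjective_pairing.
  by rewrite hE mxE eqxx mulr1n mul1r.
have La : L *m a = 0.
  apply/colP => j; rewrite [RHS]mxE.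
  have -> : (L *m a) j 0 = ev a (row j L) by rewrite /ev -row_mul [RHS]mxE.
  rewrite rowK; set g := tnth _ _; have gT : g \in T by apply: mem_tnth.
  have := hT g gT; rewrite mul_mx_row hE mulmxBr mulmxA => H.
  have -> : g *m tcol *m x0 = ev tcol g *: x0.
    by apply/rowP => l; rewrite [RHS]mxE mxE big_ord1.
  by rewrite evD evN evZ; move: H; rewrite -/(ev tcol g); nra.
rewrite /homx hE piP evD /t0 evD evN !ev_mul PiE -mulmxA La mulmx0 !ev0l.
by rewrite mxE eqxx mulr1n; lra.
Qed.

(* A real functional [f] is a nonnegative combination of integral ones which
   are tight at the same generators: if [s] is the sum of the integral generators
   [e] of the normal cone of the face, then so are [s] and all [K e + s], and
   [N f - s] is in the normal cone for [N] large. *)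
Lemma reach_real_face f : (forall g, g \in GI -> ev f g <= 0) ->
  (exists z, opt_face f z) -> lattice_free_covered k (opt_face f) -> reach f.
Proof.
move=> fGI [z1 Mz1] Hf.
have [E [EP Ei]] := minkowski (map trmx GI).
have {}Ei e : e \in E -> integral e.
  by apply: Ei => _ /mapP[g gGI ->]; apply/integral_tr/GIi.
have EP' u : (forall g, g \in GI -> ev u g <= 0) <-> cone E u^T.
  rewrite -EP; split=> [H _ /mapP[g gGI ->]|H g gGI]; first by rewrite ev_tr; apply: H.
  by rewrite -ev_tr; apply: H; apply: map_f.
(* A valid normal vanishes on all tight generators exactly when it vanishes on their sum. *)
pose v : 'cV[R]_(p + (q + 1)) := \sum_(g <- tight f) g^T.
have vE u : ev v u^T = \sum_(g <- tight f) ev u g.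
  rewrite /v /ev mulmx_sumr summxE; apply: eq_bigr => g _.
  by rewrite -trmx_mul mxE.
have tGI g : g \in tight f -> g \in GI by rewrite mem_filter => /andP[].
pose E' := [seq e <- E | ev v e == 0].
have EGI e : e \in E -> forall g, g \in GI -> ev e^T g <= 0.
  by move=> eE; apply/EP'; rewrite trmxK; apply: cone_mem.
have vE0 e : e \in E -> ev v e <= 0.
  move=> eE; rewrite -[e]trmxK vE big_seq; apply: sumr_le0 => g /tGI.
  exact: EGI.
have normal_cone u : (forall g, g \in GI -> ev u g <= 0) ->
    (forall g, g \in tight f -> ev u g = 0) -> cone E' u^T.
  move=> uGI ut; apply: cone_face => //; first exact/EP'.
  by rewrite vE big_seq big1.
have E't e g : e \in E' -> g \in tight f -> ev e^T g = 0.
  rewrite mem_filter -[e in ev v e]trmxK vE => /andP[ve eE] gt.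
  move: ve; rewrite (perm_big _ (perm_to_rem gt)) big_cons /= => /eqP ve.
  have := EGI e eE g (tGI g gt).
  have : \sum_(g <- rem g (tight f)) ev e^T g <= 0.
    by rewrite big_seq; apply: sumr_le0 => g' /mem_rem /tGI; apply: EGI.
  lra.
pose s : 'cV[R]_(p + (q + 1)) := \sum_(e <- E') e^T.
have sE g : ev s g = \sum_(e <- E') ev e^T g.
  by rewrite /s /ev mulmx_sumr summxE.
have E'E e : e \in E' -> e \in E by rewrite mem_filter => /andP[].
have sGI g : g \in GI -> ev s g <= 0.
  by move=> gGI; rewrite sE big_seq; apply: sumr_le0 => e /E'E eE; apply: EGI.
have st g : g \in tight f -> ev s g = 0.
  by move=> gt; rewrite sE big_seq big1 // => e eE; apply: E't.
have st' g : g \in GI -> ev s g = 0 -> g \in tight f.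
  move=> gGI sg; rewrite mem_filter gGI andbT eq_le fGI //= -oppr_le0.
  have fE' : cone E' f^T.
    by apply: normal_cone => // g'; rewrite mem_filter => /andP[/eqP].
  rewrite -ev_tr -evNl; apply: ev_cone fE' => e eE'.
  rewrite evNl oppr_le0 -[e]trmxK ev_tr.
  move: sg; rewrite sE (perm_big _ (perm_to_rem eE')) big_cons /=.
  have : \sum_(e <- rem e E') ev e^T g <= 0.
    by rewrite big_seq; apply: sumr_le0 => e' /mem_rem /E'E e'E; apply: EGI.
  lra.
have sint : integral s.
  rewrite /s big_seq; apply: (big_ind (fun x => integral x)).
  - exact: integral0.
  - by move=> *; apply: integralD.
  - by move=> e /E'E/Ei/integral_tr.
have reach_tight u : integral u -> (forall g, g \in GI -> ev u g <= 0) ->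
    (forall g, g \in tight f -> ev u g = 0) ->
    (forall g, g \in GI -> ev u g = 0 -> g \in tight f) ->
    reach u.
  move=> ui uGI ut ut'; have tE : tight u = tight f.
    apply: eq_in_filter => g gGI; apply/eqP/eqP => [ug|fg].
      by have := ut' g gGI ug; rewrite mem_filter => /andP[/eqP].
    by apply: ut; rewrite mem_filter fg eqxx.
  have faceE z : opt_face u z <-> opt_face f z by rewrite !opt_face_cone // tE.
  apply: reach_opt_face => //; first by exists z1; apply/faceE.
  move=> F [Fn [a [b [beta [valid FP]]]]]; apply: Hf; split=> //.
  exists a, b, beta; split=> [z /faceE/valid //|z].
  by rewrite FP faceE.
have reach_s : reach s by apply: reach_tight.
(* [nu] is independent of [K], so a large [K] can outweigh it. *)
have combine w : cone E' w ->
    exists2 nu, 0 <= nu & forall K : nat, reach (K%:R *: w^T + nu *: s).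
  apply: (cone_min (K := fun w => exists2 nu, 0 <= nu &
      forall K : nat, reach (K%:R *: w^T + nu *: s))).
  - exists 0 => // K; rewrite trmx0 scaler0 scale0r addr0.
    by apply: reach_valid => z _; rewrite ev0l.
  - move=> x y [a a0 Ha] [b b0 Hb]; exists (a + b); first exact: addr_ge0.
    move=> K; have := reachD (Ha K) (Hb K).
    by rewrite addrACA -scalerDr -scalerDl -raddfD.
  move=> t e t0 eE'; exists t => // K.
  rewrite linearZ /= scalerA mulrC -scalerA -scalerDr; apply: reachZ => //.
  have eE := E'E e eE'; apply: reach_tight.
  - by apply: integralD => //; apply: integralZ; [apply: rpred_nat|apply/integral_tr/Ei].
  - move=> g gGI; rewrite evDl evZl; have := sGI g gGI.
    have := mulr_ge0_le0 (ler0n R K) (EGI e eE g gGI); lra.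
  - by move=> g gt; rewrite evDl evZl E't // st // mulr0 addr0.
  - move=> g gGI; rewrite evDl evZl => H; apply: st' => //.
    have := mulr_ge0_le0 (ler0n R K) (EGI e eE g gGI); have := sGI g gGI; lra.
have [|g gGI fg|N HN] := @tilt _ _ GI (- s) f; first exact: fGI.
  by rewrite evNl st ?oppr0 // mem_filter fg eqxx.
pose N1 : R := (N%:R + 1)%R; have N10 : 0 < N1 by rewrite ltr_wpDl.
have [|nu nu0 Hnu] := combine (N1 *: f - s)^T.
  apply: normal_cone => g gt; rewrite !evE.
    by have := HN g gt; have := fGI g gt; rewrite evNl /N1; lra.
  by rewrite st //; move: gt; rewrite mem_filter => /andP[/eqP -> _]; rewrite mulr0 oppr0 addr0.
(* [K (N1 f - s) + nu s + (K - nu) s = K N1 f]; the choice of [K] makes [K - nu] nonnegative and [K]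
   positive. *)
have [K HK] := nat_ub (nu + 1).
have := reachD (Hnu K) (@reachZ _ _ _ _ (K%:R - nu) _ _ reach_s).
rewrite trmxK => H; have {H} : reach ((K%:R * N1) *: f).
  have := H _; rewrite subr_ge0; have nuK : nu <= K%:R by lra.
  move=> /(_ nuK); congr (reach _); apply/colP => i; rewrite !mxE; lra.
have KN : 0 < K%:R * N1 by rewrite mulr_gt0 //; lra.
have KNi : 0 <= (K%:R * N1)^-1 by rewrite invr_ge0 ltW.
by move=> /(reachZ KNi); rewrite scalerA mulVf ?scale1r // gt_eqF.
Qed.

End Main.

Local Close Scope ring_scope.
Open Scope R_scope.

Theorem theorem2p9 (p q : nat) (cs : seq ((('I_p -> Q) * ('I_q -> Q)) * Q))
  (c : 'I_p -> R) (h : 'I_q -> R) (gstar : R) (k : nat) :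
  (* P_I nonempty *)
  (exists z, integer_hull (rat_polyhedron cs) z) ->
  (* cx + hy bounded above on P *)
  (exists B, forall z, rat_polyhedron cs z -> lin c h z <= B) ->
  (* gstar = max {cx + hy : (x,y) in P_I} *)
  (exists z, integer_hull (rat_polyhedron cs) z /\ lin c h z = gstar) ->
  (forall z, integer_hull (rat_polyhedron cs) z -> lin c h z <= gstar) ->
  (2 <= k)%N ->
  (* hypothesis on nonempty faces f of M = {(x,y) in P_I : cx + hy = gstar} *)
  (forall F : pt p q -> Prop,
     nonempty_face (fun z => integer_hull (rat_polyhedron cs) z /\ lin c h z = gstar) F ->
     (forall x, relint (proj_X F) x -> ~ is_int_vec x) ->
     exists (d : 'I_k -> 'I_p -> Z) (delta : 'I_k -> Z),
       k_disjunction d delta /\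
       forall x, relint (proj_X F) x -> forall i, dot (dvec d i) x > IZR (delta i)) ->
  exists n : nat,
    is_lub (fun r => exists z, kdisj_rank k (rat_polyhedron cs) n z /\ r = lin c h z) gstar.
Proof.
move=> _ _ [z1 [z1I cz1]] maxI k2 HM; set P := rat_polyhedron cs.
have [G [Gi Gt GP]] := @rat_polyhedron_cone p q cs.
have [GI [GIi GIt GIP]] := meyer Gi Gt GP.
pose f := affine c h gstar.
have fE z : ev f (hom z) = (lin c h z - gstar)%R by rewrite ev_affine.
have fGI g : g \in GI -> (ev f g <= 0)%R.
  apply: (@valid_gen p q GI f z1) => //; first exact/GIP.
  by move=> z /GIP /maxI /RleP; rewrite fE subr_le0.
have faceE z : integer_hull P z /\ lin c h z = gstar <-> opt_face P f z.
  rewrite /opt_face fE; split=> -[zI] => [->|/eqP]; first by rewrite subrr.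
  by rewrite subr_eq0 => /eqP.
have Mz1 : opt_face P f z1 by apply/faceE.
have [z0 [z0I _] z0i] := int_opt_point GIP fGI Mz1.
have [n fn] : reach k P f.
  apply: (reach_real_face k2 Gi Gt GP GIi GIt GIP (integer_hull_sub GP z0I) z0i fGI).
    by exists z1.
  move=> F [Fn [a [b [beta [valid FP]]]]]; apply: HM; split=> //.
  exists a, b, beta; split=> [z /faceE/valid //|z].
  by rewrite FP faceE.
exists n; split=> [_ [z [zn ->]]|b ub].
  by apply/RleP; rewrite -subr_le0 -fE; apply: fn.
(* [z1] survives in every closure, so [gstar] stays attained. *)
apply: ub; exists z1; split=> //; apply: integer_hull_rank => //.
by move=> z; apply: (integer_hull_sub GP).
Qed.
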